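(* $$[\mathcal{H}_{v\mathcal{R}}^\infty,\|\cdot\|_v]=[\mathcal{V}^{-1}\circ\mathcal{H}_{v\mathcal{K}}^\infty,\|\cdot\|_{\mathcal{V}^{-1}\circ\mathcal{H}_{v\mathcal{K}}^\infty}].$$ That is, for every open subset $U$ of a complex Banach space, every weight $v$ on $U$, every complex Banach space $F$ and every $f\in\mathcal{H}_v^\infty(U,F)$: $f$ is Rosenthal weighted holomorphic if and only if $T\circ f\in\mathcal{H}_{v\mathcal{K}}^\infty(U,G)$ for every complex Banach space $G$ and every completely continuous operator $T\in\mathcal{V}(F,G)$; and in this case $\|f\|_v=\|f\|_{\mathcal{V}^{-1}\circ\mathcal{H}_{v\mathcal{K}}^\infty}$.
   Context: All Banach spaces are complex. A weight $v$ on an open subset $U$ of a Banach space is a strictly positive continuous function on $U$. $\mathcal{H}_v^\infty(U,F)$ is the Banach space of holomorphic $f:U\to F$ with $\|f\|_v:=\sup_{x\in U}v(x)\|f(x)\|<\infty$. Write $(vf)(U)=\{v(x)f(x):x\in U\}$. A subset of a Banach space is Rosenthal (conditionally weakly compact) if each sequence in it has a weakly Cauchy subsequence. $\mathcal{H}_{v\mathcal{R}}^\infty(U,F)$ is the set of Rosenthal weighted holomorphic mappings, i.e. those $f\in\mathcal{H}_v^\infty(U,F)$ for which $(vf)(U)$ is a Rosenthal subset of $F$, with norm $\|\cdot\|_v$. $\mathcal{H}_{v\mathcal{K}}^\infty(U,F)$ is the set of $f\in\mathcal{H}_v^\infty(U,F)$ for which $(vf)(U)$ is relatively compact in $F$,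 with norm $\|\cdot\|_v$. $\mathcal{V}$ is the ideal of completely continuous operators (bounded linear operators mapping weakly convergent sequences to norm convergent sequences), with the operator norm. The left-hand quotient $\mathcal{V}^{-1}\circ\mathcal{H}_{v\mathcal{K}}^\infty(U,F)$ is the set of $f\in\mathcal{H}_v^\infty(U,F)$ such that $T\circ f\in\mathcal{H}_{v\mathcal{K}}^\infty(U,G)$ for every Banach space $G$ and every $T\in\mathcal{V}(F,G)$, with norm $\|f\|_{\mathcal{V}^{-1}\circ\mathcal{H}_{v\mathcal{K}}^\infty}:=\sup\{\|T\circ f\|_v:T\in\mathcal{V}(F,G),\ \|T\|\le1\}$, $G$ ranging over all Banach spaces. Equality of ideals means equality of sets and of norms. *)

(* Defs.v *)
From HB Require Import structures.
From mathcomp Require Import all_boot all_order all_algebra.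
From mathcomp Require Import complex.
From mathcomp Require Import all_classical all_reals all_analysis.

Set Implicit Arguments.
Unset Strict Implicit.
Unset Printing Implicit Defensive.

Import Order.TTheory GRing.Theory Num.Theory.
Import numFieldNormedType.Exports.

Local Open Scope classical_set_scope.
Local Open Scope complex_scope.
Local Open Scope ring_scope.

(* A complex Banach space is a [completeNormedModType R[i]], with [R : realType].
   The library norm [`|x|] takes its values in [R[i]] (on the nonnegative real
   axis); [rnorm x] is the same number seen in [R]. *)
Definition rnorm (R : realType) (F : normedModType R[i]) (x : F) : R :=
  complex.Re `|x|.

Section WeakSequences.
Context {R : realType} {F : normedModType R[i]}.

(* The dual of F consists of the continuous R[i]-linear maps from F to R[i]^o. *)
Definition weakly_cvg (u : nat -> F) (l : F) : Prop :=
  forall phi : {linear F -> R[i]^o}, continuous phi ->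
    (phi \o u) @ \oo --> phi l.

Definition weakly_cauchy (u : nat -> F) : Prop :=
  forall phi : {linear F -> R[i]^o}, continuous phi ->
    cauchy ((phi \o u) @ \oo).

Definition rosenthal (A : set F) : Prop :=
  forall u : nat -> F, (forall n, A (u n)) ->
    exists2 s : nat -> nat,
      {homo s : m n / (m < n)%N} & weakly_cauchy (u \o s).

Definition relatively_compact (A : set F) : Prop := compact (closure A).

End WeakSequences.

Section Operators.
Context {R : realType} {F G : normedModType R[i]}.

(* For linear maps between normed spaces, continuous means bounded
   ([linear_bounded_continuous], [continuous_linear_bounded]). *)
Definition completely_continuous (T : {linear F -> G}) : Prop :=
  continuous T /\
  forall u : nat -> F, (exists l, weakly_cvg u l) -> cvgn (T \o u).

Definition opnorm (T : {linear F -> G}) : \bar R :=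
  ereal_sup [set (rnorm (T x))%:E | x in [set x : F | rnorm x <= 1]].

End Operators.

Definition weight (R : realType) (E : normedModType R[i])
    (U : set E) (v : E -> R) : Prop :=
  (forall x, U x -> 0 < v x) /\ {within U, continuous v}.

(* A mapping U -> F is represented by a total function E -> F of which only the
   values on the open set U are relevant.  Holomorphy is complex Frechet
   differentiability at every point of U. *)
Definition holomorphic_on (R : realType) (E F : normedModType R[i])
    (U : set E) (f : E -> F) : Prop :=
  forall x, U x -> differentiable f x.

Section WeightedHolomorphic.
Context {R : realType} {E : normedModType R[i]} (U : set E) (v : E -> R).

(* The maximum with 0 only matters when U is empty: it encodes the convention
   that the supremum of an empty set of nonnegative reals is 0
   (the library has [ereal_sup set0 = -oo]). *)
Definition wnorm (F : normedModType R[i]) (f : E -> F) : \bar R :=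
  maxe 0%:E (ereal_sup [set (v x * rnorm (f x))%:E | x in U]).

Definition wimage (F : normedModType R[i]) (f : E -> F) : set F :=
  [set (v x)%:C *: f x | x in U].

Definition Hv (F : normedModType R[i]) : set (E -> F) :=
  [set f | holomorphic_on U f /\ (wnorm f < +oo)%E].

Definition HvR (F : normedModType R[i]) : set (E -> F) :=
  [set f | Hv f /\ rosenthal (wimage f)].

Definition HvK (F : normedModType R[i]) : set (E -> F) :=
  [set f | Hv f /\ relatively_compact (wimage f)].

Definition VquoHvK (F : completeNormedModType R[i]) : set (E -> F) :=
  [set f | Hv f /\
    forall (G : completeNormedModType R[i]) (T : {linear F -> G}),
      completely_continuous T -> HvK (T \o f)].

Definition VquoHvK_norm (F : completeNormedModType R[i]) (f : E -> F) : \bar R :=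
  ereal_sup [set r | exists (G : completeNormedModType R[i])
                            (T : {linear F -> G}),
    [/\ completely_continuous T, (opnorm T <= 1)%E & r = wnorm (T \o f)]].

End WeightedHolomorphic.

Arguments Hv {R E} U v F _.
Arguments HvR {R E} U v F _.
Arguments HvK {R E} U v F _.
Arguments VquoHvK {R E} U v F _.

(* Main.v *)
From HB Require Import structures.
Require Import Defs.
From mathcomp Require Import all_boot all_order all_algebra.
From mathcomp Require Import complex.
From mathcomp Require Import all_classical all_reals all_analysis.
From mathcomp Require Import ring lra.

Set Implicit Arguments.
Unset Strict Implicit.
Unset Printing Implicit Defensive.

Import Order.TTheory GRing.Theory Num.Theory.
Import numFieldNormedType.Exports.

Local Open Scope classical_set_scope.
Local Open Scope complex_scope.
Local Open Scope ring_scope.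

(** The heart of the matter is that a bounded set [A] all of whose completely
    continuous images are relatively compact is Rosenthal.  If a sequence in [A]
    has no weakly Cauchy subsequence, Rosenthal's combinatorial argument yields
    reals [a < b], a subsequence [x] and, for every sign pattern [sg] on
    [{0, .., N-1}], a functional [g_sg] of norm at most 1 whose real part is
    [>= b] or [<= a] at [x j] according to [sg j].  Let [r_k] be the Rademacher
    functions and [L] the limit along an ultrafilter, as [N] tends to infinity,
    of the uniform averages over [{0,1}^N].  Then [T y = (L (r_k g_sg(y)))_k]
    maps into c_0 by Bessel's inequality while the [k]-th coordinate of [T (x k)]
    stays [>= (b - a) / 2], so [T] does not map [A] into a relatively compact set.
    It is completely continuous because [L |g_sg(w_n)|] tends to 0 for weakly null
    [w]: otherwise the sets [{|g_sg(w_n)| >= e}] have measure bounded below, some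
    infinitely many of them have the finite intersection property, and a cluster
    point of the [g_sg] along their intersections contradicts weak nullity.  Only
    finite additivity is used, so no measure theory or Hahn-Banach extension is
    needed here.  Hahn-Banach enters only in the equality of norms, through rank
    one operators. *)

(** * Independent subsequences *)

Lemma dependent_choice_nat (T : Type) (P : nat -> T -> Prop)
    (Q : nat -> T -> T -> Prop) :
  (exists x, P 0%N x) ->
  (forall n x, P n x -> exists y, P n.+1 y /\ Q n x y) ->
  exists f : nat -> T, forall n, P n (f n) /\ Q n (f n) (f n.+1).
Proof.
move=> [x0 Px0] step.
have step' (a : nat * T) : exists y, P a.1 a.2 -> P a.1.+1 y /\ Q a.1 a.2 y.
  by case: (pselect (P a.1 a.2)) => [/step[y ?]|]; [exists y|exists x0].
have [s sP] := choice step'.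
pose f := fix f n := if n is m.+1 then s (m, f m) else x0.
have Pf n : P n (f n) by elim: n => [//|n /(sP (n, _))[]].
by exists f => n; split => //; have [] := sP (n, f n) (Pf n).
Qed.

Definition unbounded_nat (L : set nat) := forall n, exists2 m, (n < m)%N & L m.

Lemma sub_unbounded_nat (L M : set nat) :
  L `<=` M -> unbounded_nat L -> unbounded_nat M.
Proof. by move=> LM uL n; have [m nm /LM] := uL n; exists m. Qed.

Lemma unbounded_natU (L M : set nat) :
  unbounded_nat (L `|` M) -> unbounded_nat L \/ unbounded_nat M.
Proof.
move=> uLM; apply: contrapT => /not_orP[/existsNP[a La] /existsNP[b Mb]].
have [m abm [Lm|Mm]] := uLM (maxn a b); [apply: La|apply: Mb]; exists m => //.
- by apply: leq_ltn_trans abm; rewrite leq_maxl.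
- by apply: leq_ltn_trans abm; rewrite leq_maxr.
Qed.

Lemma unbounded_nat_tail (L : set nat) n :
  unbounded_nat L -> unbounded_nat (L `&` [set m | (n < m)%N]).
Proof.
move=> uL k; have [m km Lm] := uL (maxn k n).
by exists m; [|split => //=]; apply: leq_ltn_trans km; rewrite ?leq_maxl ?leq_maxr.
Qed.

Lemma unbounded_nat_bigcup (I : finType) (L : set nat) (P : I -> set nat) :
  unbounded_nat L -> (forall n, L n -> exists i, P i n) ->
  exists i, unbounded_nat (L `&` P i).
Proof.
move=> uL LP; apply: contrapT => /forallNP bP.
have /choice[b bE] : forall i, exists b, forall m, L m -> P i m -> (m <= b)%N.
  move=> i; have /existsNP[b Pb] := bP i; exists b => m Lm Pm.
  by rewrite leqNgt; apply/negP => bm; apply: Pb; exists m.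
have [m bm Lm] := uL (\max_i b i).
have [i Pim] := LP m Lm.
by move: bm; rewrite ltnNge (leq_trans (bE i m Lm Pim))// leq_bigmax.
Qed.

Lemma increasing_seq_in (L : set nat) : unbounded_nat L ->
  exists2 s : nat -> nat, {homo s : m n / (m < n)%N} & forall n, L (s n).
Proof.
move=> uL.
have [|n x Lx|f fP] := @dependent_choice_nat nat (fun=> L) (fun _ m n => (m < n)%N).
- by have [m _ Lm] := uL 0%N; exists m.
- by have [m xm Lm] := uL x; exists m.
exists f; last by move=> n; have [] := fP n.
by apply: homo_ltn; [exact: ltn_trans | move=> n; have [] := fP n].
Qed.

(** Decreasing sets satisfying [Q 0], [Q 1], ... are chosen together with an increasing sequence of
    points, one from each. The range of the points lies in every one of these sets up to finitely
    many elements, which the second hypothesis tolerates. *)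
Lemma diagonal_subset (Q : nat -> set nat -> Prop) (M0 : set nat) :
  (forall k M, M `<=` M0 -> unbounded_nat M ->
     exists M', [/\ M' `<=` M, unbounded_nat M' & Q k M']) ->
  (forall k M M', Q k M -> (exists N, forall n, (N <= n)%N -> M' n -> M n) ->
     Q k M') ->
  unbounded_nat M0 ->
  exists M, [/\ M `<=` M0, unbounded_nat M & forall k, Q k M].
Proof.
move=> Qex Qsub uM0.
have [||f fP] := @dependent_choice_nat (set nat * nat)
  (fun _ a => a.1 `<=` M0 /\ unbounded_nat a.1)
  (fun k a b => [/\ b.1 `<=` a.1, Q k b.1, (a.2 < b.2)%N & b.1 b.2]).
- by exists (M0, 0%N); split.
- move=> k [M m] /= [MM0 uM]; have [M' [M'M uM' QM']] := Qex k M MM0 uM.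
  have [m' mm' M'm'] := uM' m.
  by exists (M', m'); split; split => //; exact: subset_trans MM0.
have fS k : (f k.+1).1 `<=` (f k).1 by have [_ []] := fP k.
have f1 k j : (k <= j)%N -> (f j).1 `<=` (f k).1.
  elim: j => [|j IH]; first by rewrite leqn0 => /eqP ->.
  by rewrite leq_eqVlt => /predU1P[->//|/IH]; exact: subset_trans.
have f2 : {homo (fun k => (f k).2) : m n / (m < n)%N}.
  by apply: homo_ltn; [exact: ltn_trans | move=> n; have [_ []] := fP n].
exists (range (fun k => (f k.+1).2)); split.
- move=> _ [k _ <-]; have [_ [_ _ _]] := fP k.
  by have [[+ _] _] := fP k.+1; exact.
- move=> n; exists (f n.+1).2; last by exists n.
  have : forall k, (k <= (f k).2)%N.
    by elim=> [//|k IH]; apply: leq_ltn_trans IH _; exact: f2.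
  exact.
- move=> k; have [_ [_ Qk _ _]] := fP k; apply: Qsub Qk _.
  exists (f k.+1).2 => _ /[swap] -[j _ <-] kj.
  have [_ [_ _ _ +]] := fP j; apply: f1.
  by rewrite leqNgt; apply/negP => /f2; rewrite ltnNge kj.
Qed.

(** With [C true n] and [C false n] read as [b <= g (x n)] and [g (x n) <= a], no functional [g] in
    [X] oscillates infinitely often across [[a, b]] along [M]. *)
Definition settles (T : Type) (C : bool -> nat -> set T) (M : set nat) (X : set T) :=
  forall x, X x -> exists b, ~ unbounded_nat [set n | M n /\ C b n x].

Lemma settles_almost_sub (T : Type) (C : bool -> nat -> set T) (M M' : set nat) X :
  settles C M X -> (exists N, forall n, (N <= n)%N -> M' n -> M n) ->
  settles C M' X.
Proof.
move=> sM [N M'M] x Xx; have [b Hb] := sM x Xx; exists b => /(unbounded_nat_tail N) u.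
apply: Hb; apply: sub_unbounded_nat u => n [[/= M'n Cn] Nn]; split => //.
by apply: M'M => //; exact: ltnW.
Qed.

(* A direct diagonal argument replaces Ramsey's theorem. *)
Lemma settles_split (T : Type) (C : bool -> nat -> set T) (I : finType)
    (X : I -> set T) (L : set nat) :
  unbounded_nat L ->
  (forall i M, M `<=` L -> unbounded_nat M -> ~ settles C M (X i)) ->
  exists2 n, L n & exists L', [/\ L' `<=` L, unbounded_nat L' &
    forall i b M, M `<=` L' -> unbounded_nat M -> ~ settles C M (X i `&` C b n)].
Proof.
move=> uL nsX; apply: contrapT => Hn.
(* [Q n M] records that splitting at [n] fails along [M]. If no [n] works, every infinite subset of
   [L] can be thinned to satisfy [Q n], so one set satisfies all of them. *)
pose Q n M := L n -> exists i b, settles C M (X i `&` C b n).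
have [k M ML uM|k M M' QM MM' Lk|//|M [ML uM QM]] := @diagonal_subset Q L.
- have [Lk|nLk] := pselect (L k); last by exists M; split.
  apply: contrapT => HM; apply: Hn; exists k => //.
  exists M; split => // i b M' M'M uM' sM'; apply: HM.
  by exists M'; split => // _; exists i, b.
- by have [i [b s]] := QM Lk; exists i, b; exact: settles_almost_sub s MM'.
(* Pigeonhole: a single pair [(i, b)] is responsible for infinitely many [n] in [M]. *)
have /(_ (I * bool)%type (fun ib n => settles C M (X ib.1 `&` C ib.2 n))) :=
  @unbounded_nat_bigcup _ M.
have MP n : M n -> exists ib : I * bool, settles C M (X ib.1 `&` C ib.2 n).
  by move=> /ML/(QM n)[i [b s]]; exists (i, b).
move=> /(_ uM MP)[[i b] /= uMib].
have := nsX i _ _ uMib; apply; first by apply: subset_trans ML => n [].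
move=> x Xx.
(* These [n] settle [X i]: a point in [C b n] for infinitely many of them lies in a piece settled
   along [M], and any other point is settled by [b] itself. *)
have [u|] := pselect (unbounded_nat
    [set n | (M `&` [set n | settles C M (X i `&` C b n)]) n /\ C b n x]);
  last by exists b.
have [n _ [[Mn sn] Cn]] := u 0%N.
have [b' Hb'] := sn x (conj Xx Cn); exists b' => u'; apply: Hb'.
by apply: sub_unbounded_nat u' => m [[Mm _] Cm].
Qed.

(** Indices are chosen one at a time, keeping an infinite reservoir no infinite subset of which
    settles any of the pieces [Y], one per sign pattern. An empty piece would be settled vacuously,
    so every pattern is realised. *)
Lemma independent_subsequence (T : Type) (C : bool -> nat -> set T) (X : set T)
    (L : set nat) :
  unbounded_nat L ->
  (forall M, M `<=` L -> unbounded_nat M -> ~ settles C M X) ->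
  exists2 s : nat -> nat, {homo s : m n / (m < n)%N} &
    (forall n, L (s n)) /\
    forall k (sg : nat -> bool), exists2 x, X x &
      forall j, (j < k)%N -> C (sg j) (s j) x.
Proof.
move=> uL nsX.
pose Y (l : seq nat) (sg : {ffun 'I_(size l) -> bool}) :=
  [set x | X x /\ forall j, C (sg j) (nth 0%N l j) x].
pose P (k : nat) (a : seq nat * set nat) := [/\ size a.1 = k, a.2 `<=` L,
  unbounded_nat a.2 &
  forall sg M, M `<=` a.2 -> unbounded_nat M -> ~ settles C M (@Y a.1 sg)].
pose Q (_ : nat) (a b : seq nat * set nat) :=
  exists n, [/\ L n, b.1 = rcons a.1 n & forall m, m \in a.1 -> (m < n)%N].
have [||f fP] := @dependent_choice_nat _ P Q.
- exists ([::], L); split=> //= sg M ML uM sM; apply: (nsX M ML uM) => x Xx.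
  by apply: sM; split => // -[].
- move=> k [l M] [/= sl ML uM nsM].
  (* Discarding the indices up to the largest one chosen makes the sequence increasing. *)
  have uM' := unbounded_nat_tail (\max_(m <- l) m) uM.
  have [|n [Mn ln] [L' [L'M uL' nsL']]] := @settles_split T C _ (@Y l) _ uM'.
    by move=> sg M' M'M; apply: nsM => n /M'M[].
  exists (rcons l n, L'); split; last first.
    exists n; split => //; [exact: ML|] => m ml.
    by apply: leq_ltn_trans ln; rewrite leq_bigmax_seq.
  split=> /=; [by rewrite size_rcons sl|by move=> m /L'M[/ML]|by []|].
  move=> sg M' M'L' uM'' sM'.
  have sz i : (i < size l)%N -> (i < size (rcons l n))%N.
    by rewrite size_rcons => /ltnW; rewrite ltnS.
  have szl : (size l < size (rcons l n))%N by rewrite size_rcons.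
  pose sg' : {ffun 'I_(size l) -> bool} := [ffun i => sg (Ordinal (sz _ (ltn_ord i)))].
  apply: (nsL' sg' (sg (Ordinal szl)) M' M'L' uM'') => x [[Xx lx] Cx].
  apply: sM'; split => // j.
  have := ltn_ord j; rewrite [X in (_ < X)%N]size_rcons ltnS leq_eqVlt => /predU1P[jl|jl].
    rewrite jl nth_rcons ltnn eqxx.
    by rewrite (_ : j = Ordinal szl)//; exact: val_inj.
  rewrite nth_rcons jl; have := lx (Ordinal jl); rewrite ffunE /=.
  by rewrite (_ : Ordinal _ = j)//; exact: val_inj.
have fS k : exists n, [/\ L n, (f k.+1).1 = rcons (f k).1 n &
    forall m, m \in (f k).1 -> (m < n)%N] by have [] := fP k.
have [s sP] := choice fS.
have fE k : (f k).1 = [seq s i | i <- iota 0 k].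
  elim: k => [|k IH]; first by have [[/size0nil ->]] := fP 0%N.
  by have [_ -> _] := sP k; rewrite IH -[k.+1]addn1 iotaD map_cat cats1.
exists s.
  apply: homo_ltn; first exact: ltn_trans.
  move=> k; have [_ _] := sP k.+1; apply; rewrite fE.
  by apply/mapP; exists k => //; rewrite mem_iota /=.
split=> [n|k sg]; first by have [] := sP n.
have [[sz _ uM ns] _] := fP k.
pose sg' : {ffun 'I_(size (f k).1) -> bool} := [ffun i => sg (val i)].
have [x [Xx Yx]] : exists x, Y _ sg' x.
  apply: contrapT => /forallNP Y0; apply: (ns sg' _ _ uM) => // x Yx.
  by case: (Y0 x).
exists x => // j jk.
have jk' : (j < size (f k).1)%N by rewrite sz.
have := Yx (Ordinal jk'); rewrite ffunE /= fE (nth_map 0%N) ?size_iota//.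
by rewrite nth_iota// add0n.
Qed.

(** * The real norm and the dual ball *)

Section RealNorm.
Context {R : realType} {F : normedModType R[i]}.
Implicit Types (x y : F) (c : R[i]) (t : R).

Lemma norm_rnormE x : `|x| = (rnorm x)%:C.
Proof. by rewrite /rnorm RRe_real// normr_real. Qed.

Lemma rnorm_ge0 x : 0 <= rnorm x.
Proof. by rewrite -ler0c -norm_rnormE. Qed.

Lemma rnormD x y : rnorm (x + y) <= rnorm x + rnorm y.
Proof. by rewrite -lecR rmorphD /= -!norm_rnormE ler_normD. Qed.

Lemma rnormN x : rnorm (- x) = rnorm x.
Proof. by rewrite /rnorm normrN. Qed.

Lemma rnormBC x y : rnorm (x - y) = rnorm (y - x).
Proof. by rewrite -rnormN opprB. Qed.

Lemma rnorm0 : rnorm (0 : F) = 0.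
Proof. by rewrite /rnorm normr0. Qed.

Lemma rnorm0_eq0 x : rnorm x = 0 -> x = 0.
Proof. by move=> x0; apply: normr0_eq0; rewrite norm_rnormE x0. Qed.

Lemma rnormZ c x : rnorm (c *: x) = complex.Re `|c| * rnorm x.
Proof.
by apply: complexI; rewrite [RHS]rmorphM -norm_rnormE normrZ norm_rnormE; congr (_ * _).
Qed.

Lemma rnormZr t x : rnorm (t%:C *: x) = `|t| * rnorm x.
Proof.
by rewrite rnormZ normc_def /= expr0n /= addr0 sqrtr_sqr.
Qed.

Lemma rnormZi x : rnorm ('i *: x) = rnorm x.
Proof. by rewrite rnormZ normc_def /= expr0n /= add0r expr1n sqrtr1 mul1r. Qed.

Lemma gt0_complexE c : 0 < c -> c = (complex.Re c)%:C /\ 0 < complex.Re c.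
Proof. by case: c => a b; rewrite ltcE /= => /andP[/eqP -> ?]. Qed.

Lemma cvg_rnormP {T} (G : set_system T) {FG : Filter G} (f : T -> F) (l : F) :
  f @ G --> l <-> forall e : R, 0 < e -> \forall t \near G, rnorm (l - f t) < e.
Proof.
split=> [/cvgrPdist_lt fl e e0|fl].
  have /fl : 0 < e%:C by rewrite ltcR.
  by apply: filterS => t; rewrite norm_rnormE ltcR.
apply/cvgrPdist_lt => e /gt0_complexE[-> /fl].
by apply: filterS => t; rewrite norm_rnormE ltcR.
Qed.

End RealNorm.

Lemma rnormC_Re (R : realType) (z : R[i]^o) : `|complex.Re z| <= rnorm z.
Proof. by rewrite -lecR -norm_rnormE; exact: normc_ge_Re. Qed.

Lemma rnormC_Im (R : realType) (z : R[i]^o) : `|complex.Im z| <= rnorm z.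
Proof.
have := rnormC_Re ('i *: z : R[i]^o); rewrite rnormZi.
by rewrite /GRing.scale /= mulrC ReiNIm normrN.
Qed.

Lemma rnormC_le (R : realType) (z : R[i]^o) :
  rnorm z <= `|complex.Re z| + `|complex.Im z|.
Proof.
rewrite [X in rnorm X]complexE (le_trans (rnormD _ _))// lerD//.
  by rewrite /rnorm normc_def /= expr0n /= addr0 sqrtr_sqr.
have -> : 'i * (complex.Im z)%:C = 'i *: ((complex.Im z)%:C : R[i]^o) by [].
by rewrite rnormZi /rnorm normc_def /= expr0n /= addr0 sqrtr_sqr.
Qed.

Lemma Re_linear_i (R : realType) (F : normedModType R[i])
  (phi : {linear F -> R[i]^o}) x : complex.Re (phi ('i *: x)) = - complex.Im (phi x).
Proof. by rewrite linearZ -[LHS]/(complex.Re ('i * phi x)) mulrC ReiNIm. Qed.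

Section LinearBound.
Context {R : realType} {F G : normedModType R[i]} (T : {linear F -> G}).

Lemma bounded_rnorm_continuous (M : R) :
  (forall x, rnorm (T x) <= M * rnorm x) -> continuous T.
Proof.
move=> TM x; apply/cvg_rnormP => e e0.
have M0 : 0 < `|M| + 1 by rewrite ltr_wpDl.
have /cvg_rnormP/(_ (e / (`|M| + 1))) : (fun y : F => y) @ x --> x by exact: cvg_id.
rewrite divr_gt0// => /(_ isT); apply: filterS => y.
rewrite ltr_pdivlMr// => xy; rewrite -linearB (le_lt_trans (TM _))//.
apply: le_lt_trans xy; rewrite mulrC ler_wpM2l ?rnorm_ge0//.
by rewrite (le_trans (ler_norm _))// lerDl.
Qed.

Lemma continuous_rnorm_bounded : continuous T ->
  exists2 M : R, 0 < M & forall x, rnorm (T x) <= M * rnorm x.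
Proof.
move=> /linear_lipschitz[k /gt0_complexE[-> k0] kT].
by exists (complex.Re k) => // x; rewrite -lecR rmorphM /= -!norm_rnormE.
Qed.

End LinearBound.

Section DualBall.
Context {R : realType} {F : normedModType R[i]}.
Implicit Types (g : F -> R).

(* Real parts of the complex functionals of norm at most 1; see [cplx]. *)
Definition dball g := [/\ forall x y, g (x + y) = g x + g y,
  forall t x, g (t%:C *: x) = t * g x & forall x, g x <= rnorm x].

Lemma dballN g : dball g -> dball (fun x => - g x).
Proof.
move=> [gD gZ gle]; split=> [x y|t x|x]; rewrite ?gD ?gZ ?opprD ?mulrN//.
by rewrite -mulN1r -gZ (le_trans (gle _))// rnormZr normrN normr1 mul1r.
Qed.

Lemma dball_norm g x : dball g -> `|g x| <= rnorm x.
Proof.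
move=> gB; have [_ _ gle] := gB; have [_ _ gleN] := dballN gB.
by rewrite ler_norml gle andbT lerNl gleN.
Qed.

Lemma dballB g x y : dball g -> g (x - y) = g x - g y.
Proof.
move=> [gD gZ _].
by rewrite gD -scaleN1r -[-1](rmorphN1 (real_complex R)) gZ mulN1r.
Qed.

Lemma dball_i g : dball g -> dball (fun x => g ('i *: x)).
Proof.
move=> [gD gZ gle]; split=> [x y|t x|x]; first by rewrite scalerDr gD.
- by rewrite scalerA mulrC -scalerA gZ.
- by rewrite -[leRHS]rnormZi gle.
Qed.

(** [g x - i g (i x)] is the complex functional with real part [g]. The proof [gB] is an argument so
    that a linear structure can be attached. *)
Definition cplx g (gB : dball g) (x : F) : R[i]^o := (g x +i* (- g ('i *: x))).

Lemma cplx_is_linear g (gB : dball g) : linear (cplx gB).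
Proof.
move=> [p q] x y; have [gD gZ _] := gB; rewrite /cplx.
have E z : (p +i* q) *: z = p%:C *: z + q%:C *: ('i *: z) :> F.
  by rewrite scalerA -scalerDl [in LHS](complexE (p +i* q)) /= mulrC.
have ii z : 'i *: ('i *: z) = (-1)%:C *: z :> F.
  by rewrite scalerA -expr2 sqr_i rmorphN1.
have sE (a b : R) : (p +i* q) *: ((a +i* b) : R[i]^o) =
    (p * a - q * b) +i* (p * b + q * a).
  by [].
rewrite sE E !(gD, scalerDr) !gZ.
have -> : g ('i *: (p%:C *: x)) = p * g ('i *: x) by rewrite scalerA mulrC -scalerA gZ.
have -> : g ('i *: (q%:C *: ('i *: x))) = - (q * g x).
  by rewrite scalerA mulrC -scalerA ii !gZ mulN1r mulrN.
by apply/eqP; rewrite eq_complex /=; apply/andP; split; apply/eqP; ring.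
Qed.

HB.instance Definition _ g (gB : dball g) :=
  GRing.isLinear.Build R[i] F R[i]^o _ (cplx gB) (cplx_is_linear gB).

Lemma rnorm_cplx_le g (gB : dball g) x :
  rnorm (cplx gB x) <= `|g x| + `|g ('i *: x)|.
Proof. by rewrite (le_trans (rnormC_le _))//= normrN. Qed.

Lemma cplx_continuous g (gB : dball g) : continuous (cplx gB).
Proof.
apply: (@bounded_rnorm_continuous _ _ _ (cplx gB) 2) => x.
rewrite (le_trans (rnorm_cplx_le _ _))// mulr_natl mulr2n lerD//.
  exact: dball_norm.
by rewrite -[leRHS]rnormZi dball_norm.
Qed.

Lemma continuous_dball (phi : {linear F -> R[i]^o}) : continuous phi ->
  exists2 M : R, 0 < M & dball (fun x => complex.Re (phi x) / M).
Proof.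
move=> /continuous_rnorm_bounded[M M0 phiM]; exists M => //; split=> [x y|t x|x].
- by rewrite linearD; case: (phi x) (phi y) => [? ?] [? ?] /=; rewrite mulrDl.
- by rewrite linearZ /GRing.scale /=; case: (phi x) => a b /=; simpc => /=; rewrite mulrA.
- rewrite ler_pdivrMr// mulrC (le_trans _ (phiM x))//.
  by rewrite (le_trans (ler_norm _))// rnormC_Re.
Qed.

Lemma weakly_cvg_dball (u : nat -> F) l g :
  weakly_cvg u l -> dball g -> g \o u @ \oo --> g l.
Proof.
move=> ul gB; have /cvg_rnormP h := ul _ (@cplx_continuous g gB).
apply/cvgrPdist_lt => e /h; apply: filterS => n /=; apply: le_lt_trans.
by rewrite -linearB -(dballB _ _ gB) -[g _]/(complex.Re (cplx gB _)) rnormC_Re.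
Qed.

(** A functional [phi] is tested through its real part at [x] and at [i x], the latter being minus
    its imaginary part at [x]. Division by a bound [M] puts both in the dual ball. *)
Lemma dball_weakly_cvg (u : nat -> F) l :
  (forall g, dball g -> g \o u @ \oo --> g l) -> weakly_cvg u l.
Proof.
move=> H phi cphi; have [M M0 pB] := continuous_dball cphi.
have cRe : (fun n => complex.Re (phi (u n)) / M) @ \oo -->
    complex.Re (phi l) / M by exact: (H _ pB).
have cIm : (fun n => complex.Re (phi ('i *: u n)) / M) @ \oo -->
    complex.Re (phi ('i *: l)) / M.
  exact: (H _ (dball_i pB)).
apply/cvg_rnormP => e e0; have e2 : 0 < e / 2 / M by rewrite !divr_gt0.
move/cvgrPdist_lt/(_ _ e2): cRe; move/cvgrPdist_lt/(_ _ e2): cIm.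
apply: filterS2 => n /=.
rewrite -!mulrBl !normrM [`|M^-1|]gtr0_norm ?invr_gt0// !ltr_pM2r ?invr_gt0//.
rewrite !Re_linear_i.
move=> hI hR; rewrite (le_lt_trans (rnormC_le _))// [ltRHS](splitr e) ltrD//.
  by move: hR; case: (phi l) (phi (u n)) => [? ?] [? ?].
by move: hI; rewrite -opprD normrN; case: (phi l) (phi (u n)) => [? ?] [? ?].
Qed.

Lemma dball_weakly_cauchy (u : nat -> F) :
  (forall g, dball g -> cvgn (g \o u)) -> weakly_cauchy u.
Proof.
move=> H phi cphi; have [M M0 pB] := continuous_dball cphi.
pose a := lim ((fun n => complex.Re (phi (u n)) / M) @ \oo).
pose b := lim ((fun n => complex.Re (phi ('i *: u n)) / M) @ \oo).
have cRe : (fun n => complex.Re (phi (u n)) / M) @ \oo --> a by exact: (H _ pB).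
have cIm : (fun n => complex.Re (phi ('i *: u n)) / M) @ \oo --> b.
  exact: (H _ (dball_i pB)).
apply: (@cvg_cauchy R[i]^o); apply/cvg_ex; exists ((M * a) +i* (- (M * b))).
apply/(@cvg_rnormP R R[i]^o) => e e0; have e2 : 0 < e / 2 / M by rewrite !divr_gt0.
move/cvgrPdist_lt/(_ _ e2): cRe; move/cvgrPdist_lt/(_ _ e2): cIm.
apply: filterS2 => n /=.
rewrite Re_linear_i.
have key (s t : R) : `|s - t / M| < e / 2 / M -> `|M * s - t| < e / 2.
  rewrite ltr_pdivlMr// mulrC -{1}(gtr0_norm M0) -normrM mulrBr mulrCA.
  by rewrite divff ?gt_eqF// mulr1.
move=> /key hI /key hR; rewrite (le_lt_trans (rnormC_le _))// [ltRHS](splitr e) ltrD//.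
  by move: hR; case: (phi (u n)).
by move: hI; case: (phi (u n)) => ? ? /=; rewrite opprK -opprD normrN.
Qed.

Lemma weakly_cauchy_dball (u : nat -> F) g :
  weakly_cauchy u -> dball g -> cvgn (g \o u).
Proof.
move=> cu gB; have /cauchy_ballP h := cu _ (@cplx_continuous g gB).
apply/cauchy_cvgP/cauchy_ballP => e e0.
have /h : 0 < e%:C by rewrite ltcR.
rewrite !near_simpl; apply: filterS => -[m n] /=.
rewrite -!ball_normE /= => mn; rewrite -ltcR; apply: le_lt_trans mn.
rewrite norm_rnormE lecR -linearB -(dballB _ _ gB) -[g _]/(complex.Re (cplx gB _)).
exact: rnormC_Re.
Qed.

End DualBall.

(** * Finitely additive means *)

Section Mean.
Context {R : realType} {T : Type}.
Implicit Types (f g : T -> R) (L : (T -> R) -> R).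

Definition bfun f := exists M, forall t, `|f t| <= M.

(* Finitely additive probabilities, as functionals on bounded functions; the
   value on unbounded functions is irrelevant. *)
Definition mean L := [/\
  forall f g, bfun f -> bfun g -> L (fun t => f t + g t) = L f + L g,
  forall c f, bfun f -> L (fun t => c * f t) = c * L f,
  forall f g, bfun f -> bfun g -> (forall t, f t <= g t) -> L f <= L g &
  L (fun=> 1) = 1].

Lemma bfun_cst c : bfun (fun=> c).
Proof. by exists `|c|. Qed.

Lemma bfunD f g : bfun f -> bfun g -> bfun (fun t => f t + g t).
Proof.
move=> [M fM] [N gN]; exists (M + N) => t.
by rewrite (le_trans (ler_normD _ _))// lerD.
Qed.

Lemma bfunM f g : bfun f -> bfun g -> bfun (fun t => f t * g t).
Proof. by move=> [M fM] [N gN]; exists (M * N) => t; rewrite normrM ler_pM. Qed.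

Lemma bfun_abs f : bfun f -> bfun (fun t => `|f t|).
Proof. by move=> [M fM]; exists M => t; rewrite normr_id. Qed.

Lemma bfunN f : bfun f -> bfun (fun t => - f t).
Proof. by move=> [M fM]; exists M => t; rewrite normrN. Qed.

Lemma bfun_indic (A : set T) : bfun (\1_A : T -> R).
Proof. by exists 1 => t; rewrite indicE; case: (_ \in _); rewrite ?normr1 ?normr0. Qed.

Section MeanTheory.
Variables (L : (T -> R) -> R) (LP : mean L).

Lemma meanD f g : bfun f -> bfun g -> L (fun t => f t + g t) = L f + L g.
Proof. by have [H _ _ _] := LP; exact: H. Qed.

Lemma meanZ c f : bfun f -> L (fun t => c * f t) = c * L f.
Proof. by have [_ H _ _] := LP; exact: H. Qed.

Lemma mean_le f g : bfun f -> bfun g -> (forall t, f t <= g t) -> L f <= L g.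
Proof. by have [_ _ H _] := LP; exact: H. Qed.

Lemma mean_cst c : L (fun=> c) = c.
Proof.
rewrite (_ : (fun=> c) = (fun t : T => c * 1)); last by apply/funext => t; rewrite mulr1.
by rewrite meanZ; [have [_ _ _ ->] := LP; rewrite mulr1|exact: bfun_cst].
Qed.

Lemma meanN f : bfun f -> L (fun t => - f t) = - L f.
Proof.
move=> bf; rewrite -mulN1r -meanZ//; congr L.
by apply/funext => t; rewrite mulN1r.
Qed.

Lemma mean_le_cst f c : bfun f -> (forall t, f t <= c) -> L f <= c.
Proof.
by move=> bf fc; rewrite -[leRHS]mean_cst mean_le//; exact: bfun_cst.
Qed.

Lemma mean_ge_cst f c : bfun f -> (forall t, c <= f t) -> c <= L f.
Proof.
by move=> bf fc; rewrite -[leLHS]mean_cst mean_le//; exact: bfun_cst.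
Qed.

Lemma mean_norm_le f : bfun f -> `|L f| <= L (fun t => `|f t|).
Proof.
move=> bf; have baf := bfun_abs bf; have bnf := bfunN bf.
rewrite ler_norml lerNl -meanN//; apply/andP; split; apply: mean_le => // t.
  by rewrite -normrN ler_norm.
exact: ler_norm.
Qed.

Lemma mean_sum n (f : nat -> T -> R) : (forall k, bfun (f k)) ->
  bfun (fun t => \sum_(k < n) f k t) /\
  L (fun t => \sum_(k < n) f k t) = \sum_(k < n) L (f k).
Proof.
move=> bf; elim: n => [|n [IHb IH]].
  rewrite (_ : (fun t : T => _) = fun=> 0) ?big_ord0 ?mean_cst; last first.
    by apply/funext => t; rewrite big_ord0.
  by split => //; exact: bfun_cst.
rewrite (_ : (fun t : T => _) = fun t => \sum_(k < n) f k t + f n t); last first.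
  by apply/funext => t; rewrite big_ord_recr.
by rewrite meanD// IH big_ord_recr/=; split => //; exact: bfunD.
Qed.

End MeanTheory.
End Mean.

(** * Limits of bounded sequences along a free ultrafilter *)

Section UltraLimit.
Context {R : realType}.

Definition ultra_nat : set_system nat :=
  projT1 (cid (ultraFilterLemma eventually_filter)).

#[export] Instance ultra_nat_ultra : UltraFilter ultra_nat.
Proof. by rewrite /ultra_nat; case: cid => ? []. Qed.

Lemma ultra_nat_eventually : \oo `<=` ultra_nat.
Proof. by rewrite /ultra_nat; case: cid => ? []. Qed.

Definition ulim (a : nat -> R) : R := lim (a @ ultra_nat).

Lemma ulim_cvg a : bfun a -> a @ ultra_nat --> ulim a.
Proof.
case=> M aM; suff [l al] : exists l : R, a @ ultra_nat --> l by apply: (cvgP l).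
have := @segment_compact R (- M) M; rewrite compact_ultra.
have UF : UltraFilter (a @ ultra_nat).
  split => [|G GF aG]; first exact: fmap_proper_filter.
  rewrite predeqE => A; split => [GA|]; last exact: aG.
  have [//|UA] := in_ultra_setVsetC (a @^-1` A) ultra_nat_ultra.
  have /filter_ex[x [Ax]] : G (A `&` ~` A) by apply: filterI => //; exact: aG.
  by [].
move=> /(_ _ UF)[|l [_ al]]; last by exists l.
apply: (@filterS _ ultra_nat _ setT); last exact: filterT.
by move=> n _ /=; rewrite in_itv /= -ler_norml.
Qed.

Lemma ulim_eq a l : a @ ultra_nat --> l -> ulim a = l.
Proof. by move/cvg_lim; exact. Qed.

Lemma ulim_near_le a b : bfun a -> bfun b ->
  (\forall n \near \oo, a n <= b n) -> ulim a <= ulim b.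
Proof.
move=> ba bb /ultra_nat_eventually ab.
exact: (ler_cvg_to (ulim_cvg ba) (ulim_cvg bb) ab).
Qed.

Lemma ulim_mean : mean ulim.
Proof.
split=> [f g bf bg|c f bf|f g bf bg fg|].
- by apply: ulim_eq; apply: cvgD; exact: ulim_cvg.
- by apply: ulim_eq; apply: cvgMr; exact: ulim_cvg.
- by apply: ulim_near_le => //; exact: nearW.
- by apply: ulim_eq; exact: cvg_cst.
Qed.

Lemma ulim_abs a : bfun a -> ulim (fun n => `|a n|) = `|ulim a|.
Proof. by move=> ba; apply: ulim_eq; apply: cvg_norm; exact: ulim_cvg. Qed.

End UltraLimit.

Section MeanDball.
Context {R : realType} {F : normedModType R[i]} {T : Type}.
Variables (L : (T -> R) -> R) (LP : mean L).

Lemma bfun_dball (g : T -> F -> R) x :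
  (forall t, dball (g t)) -> bfun (fun t => g t x).
Proof. by move=> gB; exists (rnorm x) => t; exact: dball_norm. Qed.

Lemma mean_dball (g : T -> F -> R) (r : T -> R) :
  (forall t, dball (g t)) -> (forall t, `|r t| <= 1) ->
  dball (fun x => L (fun t => r t * g t x)).
Proof.
move=> gB r1; have br : bfun r by exists 1.
have bg x := bfunM br (bfun_dball x gB); split=> [x y|c x|x].
- rewrite -meanD//; congr L; apply/funext => t.
  by have [-> _ _] := gB t; rewrite mulrDr.
- rewrite -meanZ//; congr L; apply/funext => t.
  by have [_ -> _] := gB t; rewrite mulrCA.
- apply: mean_le_cst => // t; rewrite (le_trans (ler_norm _))// normrM.
  by rewrite -[leRHS]mul1r ler_pM// dball_norm.
Qed.

End MeanDball.

(** Pointwise ultrafilter limits serve as weak-star cluster points, as in the Banach-Alaoglu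
    theorem. *)
Lemma ulim_dball (R : realType) (F : normedModType R[i]) (g : nat -> F -> R) :
  (forall n, dball (g n)) -> dball (fun x => ulim (fun n => g n x)).
Proof.
move=> gB; have := @mean_dball R F nat _ ulim_mean g (fun=> 1) gB.
rewrite (_ : (fun x => _) = fun x => ulim (fun n => g n x)).
  by apply=> t; rewrite normr1.
by apply/funext => x; congr ulim; apply/funext => n; rewrite mul1r.
Qed.

(** * Weakly null sequences and means *)

(* Gliding hump. *)
Lemma dball_uniform_boundedness (R : realType) (F : normedModType R[i])
    (w : nat -> F) :
  (forall g : F -> R, dball g -> bfun (fun n => g (w n))) ->
  exists M : R, forall g n, dball g -> `|g (w n)| <= M.
Proof.
move=> wb; apply: contrapT => /forallNP unb.
have {}unb M : exists g n, dball g /\ M < g (w n).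
  have /existsNP[g /existsNP[n /not_implyP[gB /negP]]] := unb M.
  rewrite -ltNge; have [g0|g0] := leP 0 (g (w n)) => Mg.
    by exists g, n; rewrite -(ger0_norm g0).
  by exists (fun x => - g x), n; rewrite -(ltr0_norm g0); split => //; exact: dballN.
pose e (k : nat) : R := 2^-1 ^+ k.
have e0 k : 0 < e k by rewrite exprn_gt0// invr_gt0.
have eS k : e k.+1 + e k.+1 = e k by rewrite /e exprS; move: (2^-1 ^+ k) => x; lra.
(* A state [(psi, W, n)] holds a functional of norm at most [1 - e k], a bound [W] for the norms of
   the points met so far, and the index of the latest point. The slack [e k] leaves room for later
   corrections. *)
pose P k (a : (F -> R) * R * nat) := [/\ dball a.1.1,
  forall x, a.1.1 x <= (1 - e k) * rnorm x & 0 <= a.1.2].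
pose Q k (a b : (F -> R) * R * nat) := [/\ a.1.2 <= b.1.2,
  rnorm (w b.2) <= b.1.2, k.+1%:R < b.1.1 (w b.2) &
  forall x, `|b.1.1 x - a.1.1 x| <= e k.+1 / (1 + a.1.2) * rnorm x].
have [||f fP] := @dependent_choice_nat _ P Q.
- exists ((fun=> 0), 0, 0%N); split => //=.
    by split=> [x y|t x|x] /=; rewrite ?addr0 ?mulr0// rnorm_ge0.
  by move=> x; rewrite /e expr0 subrr mul0r.
- move=> k [[psi W] n] [/= psiB psile W0]; have [K psiK] := wb _ psiB.
  (* With this [c], adding [c * g] changes the value at earlier points by at most [e k.+1]. Then [g]
     is taken so large at [w m] that the sum exceeds [k.+1] there, although [psi] may contribute as
     little as [- K]. *)
  pose c := e k.+1 / (1 + W).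
  have W1 : 0 < 1 + W by rewrite ltr_wpDr.
  have c0 : 0 < c by rewrite divr_gt0.
  have ce : c <= e k.+1 by rewrite ler_pdivrMr// ler_peMr ?lerDl// ltW.
  have [g [m [gB gm]]] := unb ((K + k.+1%:R) / c).
  have [psiD psiZ _] := psiB; have [gD gZ gle] := gB.
  have psi'le x : psi x + c * g x <= (1 - e k.+1) * rnorm x.
    rewrite (_ : 1 - e k.+1 = (1 - e k) + e k.+1); last by rewrite -(eS k); ring.
    rewrite mulrDl lerD// (le_trans (y := c * rnorm x))//.
      by rewrite ler_wpM2l// ltW.
    by rewrite ler_wpM2r// rnorm_ge0.
  exists ((fun x => psi x + c * g x), Num.max W (rnorm (w m)), m); split; split => /=.
  + split=> [x y|t x|x]; rewrite ?psiD ?gD ?psiZ ?gZ; try ring.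
    rewrite (le_trans (psi'le x))// ler_piMl ?rnorm_ge0// gerBl.
    exact: ltW.
  + exact: psi'le.
  + by rewrite le_max W0.
  + by rewrite le_max lexx.
  + by rewrite le_max lexx orbT.
  + move: gm; rewrite ltr_pdivrMr// mulrC => gm.
    have := psiK m; rewrite ler_norml => /andP[h _]; lra.
  + move=> x; rewrite addrAC subrr add0r normrM (gtr0_norm c0).
    by rewrite ler_wpM2l ?(ltW c0)// dball_norm.
pose psi k := (f k).1.1; pose W k := (f k).1.2; pose y k := w (f k).2.
have psiB k : dball (psi k) by have [[]] := fP k.
have Wy k j : (k < j)%N -> rnorm (y k.+1) <= W j.
  elim: j => [//|j IH]; rewrite ltnS leq_eqVlt => /predU1P[->|/IH kj].
    by have [_ []] := fP j.
  by apply: le_trans kj _; have [_ []] := fP j.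
(* The corrections made after stage [k.+1] form a geometric sum. *)
have hump k j : (k < j)%N -> `|psi j (y k.+1) - psi k.+1 (y k.+1)| <= 1 - e j.
  elim: j => [//|j IH]; rewrite ltnS leq_eqVlt => /predU1P[->|kj].
    by rewrite subrr normr0 subr_ge0 exprn_ile1// ?invr_ge0// invf_le1// ler1n.
  rewrite (_ : 1 - e j.+1 = e j.+1 + (1 - e j)); last by rewrite -(eS j); ring.
  rewrite -(subrKA (psi j (y k.+1))) (le_trans (ler_normD _ _))// lerD//.
    have [[_ _ W0] [_ _ _ /(_ (y k.+1))]] := fP j; move/le_trans; apply.
    rewrite mulrAC ler_pdivrMr ?ltr_wpDr// ler_wpM2l ?(ltW (e0 _))//.
    by rewrite (le_trans (Wy _ _ kj))// lerDr.
  exact: IH.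
(* The limit functional is at least [k] at [y k.+1] for every [k], so it is unbounded along [w]. *)
have /wb[K psiK] := ulim_dball psiB.
pose k := (Num.bound `|K|).+1.
have bp : bfun (fun n => psi n (y k.+1)) by exact: bfun_dball.
have : k%:R <= ulim (fun n => psi n (y k.+1)).
  rewrite -[leLHS](mean_cst (@ulim_mean R)).
  apply: ulim_near_le => //; first exact: bfun_cst.
  exists k.+1 => // j /= kj; have := hump k j kj; rewrite ler_norml => /andP[+ _].
  have [_ [_ _ + _]] := fP k; rewrite -[w _]/(y k.+1) -[_.1.1]/(psi k.+1).
  by have := e0 j; rewrite -[k.+1%:R]natr1; lra.
apply/negP; rewrite -ltNge (le_lt_trans (ler_norm _))// (le_lt_trans (psiK _))//.
rewrite (le_lt_trans (ler_norm _))// /k -natr1 ltr_pwDr// ltW//.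
exact: archi_boundP.
Qed.

(** * Finite intersections of sets whose mean is bounded below *)

Section FiniteIntersection.
Context {R : realType} {T : Type} (L : (T -> R) -> R) (LP : mean L).
Implicit Types (A B D : set T).
Let mu D : R := L \1_D.

Lemma mean_indicID A D : mu D = mu (D `&` A) + mu (D `\` A).
Proof.
rewrite /mu -(meanD LP); [|exact: bfun_indic..].
congr L; apply/funext => t; rewrite !indicE in_setI in_setD.
by case: (t \in A); case: (t \in D); rewrite ?addr0 ?add0r.
Qed.

Lemma mean_indic_le A D : A `<=` D -> mu A <= mu D.
Proof.
move=> AD; apply: (mean_le LP); [exact: bfun_indic..|move=> t].
rewrite !indicE; have [tA|tA] := pselect (A t); last by rewrite (memNset tA).
by rewrite !mem_set//; exact: AD.
Qed.

(* If almost all the overlaps [A n `&` A n'] with a fixed [A n] are small,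
   removing [A n] from [D] costs [mu D] a fixed amount [eta]. *)
Lemma overlapping_sets (A : nat -> set T) (eta theta : R) (K : nat) :
  0 < eta -> 0 <= theta ->
  forall D (N : set nat), unbounded_nat N ->
  (forall n, N n -> eta + K%:R * theta <= mu (D `&` A n)) -> mu D <= K%:R * eta ->
  exists2 n, N n & exists N', [/\ N' `<=` N, unbounded_nat N' &
    forall n', N' n' -> theta <= mu (D `&` A n `&` A n')].
Proof.
move=> eta0 theta0; elim: K => [|K IH] D N uN NA Dle; have [n _ Nn] := uN 0%N.
  have := NA n Nn; rewrite mul0r addr0 => /(lt_le_trans eta0).
  rewrite ltNge => /negP[]; move: Dle; rewrite mul0r; apply: le_trans.
  by apply: mean_indic_le => t [].
(* If [big] contains only finitely many indices of [N], the induction continues in [D] minus [A n]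
   with the others: each [A n'] loses less than [theta] there, while [D] loses at least [eta]. *)
pose big := [set n' | theta <= mu (D `&` A n `&` A n')].
have [] := @unbounded_natU (N `&` big) (N `\` big); first by rewrite setUIDK.
  move=> uN'; exists n => //; exists (N `&` big); split=> //; first by move=> ? [].
move=> /(IH (D `\` A n))[n' [Nn' /negP]||n1 [Nn1 _] [N' [N'N uN' N'A]]].
- rewrite -ltNge => nbig.
  have := NA n' Nn'; rewrite (mean_indicID (A n)) -natr1 mulrDl mul1r.
  have -> : D `&` A n' `&` A n = D `&` A n `&` A n' by rewrite setIAC.
  have -> : (D `&` A n') `\` A n = (D `\` A n) `&` A n'.
    by apply/seteqP; split=> t [[]].
  lra.
- have := NA n Nn; move: Dle; rewrite (mean_indicID (A n)) -natr1 !mulrDl !mul1r.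
  have -> : D `&` (A n) = A n `&` D by rewrite setIC.
  have : 0 <= K%:R * theta by rewrite mulr_ge0.
  by rewrite (setIC (A n)); lra.
- exists n1 => //; exists N'; split => // [k /N'N[]//|k /N'A /le_trans]; apply.
  by apply: mean_indic_le => t [[[]]].
Qed.

(** The iteration keeps the intersection [D] of the sets chosen so far and an infinite reservoir of
    [n] for which the mean of [D] intersected with [A n] is at least some [e > 0]. The bound shrinks
    at each stage but stays positive, so no intersection is empty. *)
Lemma finite_intersection_subsequence (A : nat -> set T) (d : R) :
  0 < d -> (forall n, d <= L \1_(A n)) ->
  exists2 s : nat -> nat, {homo s : m n / (m < n)%N} &
    forall k, exists t, forall j, (j < k)%N -> A (s j) t.
Proof.
move=> d0 Ad.
pose P (_ : nat) (a : set T * set nat) := unbounded_nat a.2 /\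
  exists2 e : R, 0 < e & forall n, a.2 n -> e <= L \1_(a.1 `&` A n).
pose Q (_ : nat) (a b : set T * set nat) := exists2 n, a.2 n &
  b.1 = a.1 `&` A n /\ b.2 `<=` a.2 `&` [set m | (n < m)%N].
have [||f fP] := @dependent_choice_nat _ P Q.
- exists (setT, setT); split => /=; first by move=> n; exists n.+1.
  by exists d => // n _; rewrite setTI.
- move=> k [D N] [/= uN [e e0 eN]].
  (* With [eta = e / 2] and [theta = e / 2 / K], [eta + K theta] equals [e]; and [K > 2 / e] gives
     [K eta >= 1], which bounds the mean of any indicator. *)
  have eta0 : 0 < e / 2 by rewrite divr_gt0.
  pose K := Num.bound (e / 2)^-1.
  have K0 : (0 : R) < K%:R.
    by apply: le_lt_trans (archi_boundP _); rewrite ?invr_ge0 ltW.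
  have theta0 : 0 < e / 2 / K%:R by rewrite divr_gt0.
  have [||n Nn [N' [N'N uN' N'A]]] :=
    @overlapping_sets A _ _ K eta0 (ltW theta0) D N uN.
  + by move=> n /eN; rewrite mulrCA divff ?gt_eqF// mulr1 -splitr.
  + apply: (@le_trans _ _ 1).
      apply: (mean_le_cst LP); first exact: bfun_indic.
      by move=> t; rewrite indicE lern1; case: (_ \in _).
    rewrite -ler_pdivrMr// div1r ltW// archi_boundP// invr_ge0 ltW//.
  exists (D `&` A n, N' `&` [set m | (n < m)%N]); split.
    by split => /=; [exact: unbounded_nat_tail|exists (e / 2 / K%:R) => // n' [/N'A]].
  by exists n => //; split => // m [/N'N].
have fS k : exists n, (f k).2 n /\ ((f k.+1).1 = (f k).1 `&` A n /\
    (f k.+1).2 `<=` (f k).2 `&` [set m | (n < m)%N]).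
  by have [_ [n ? ?]] := fP k; exists n.
have [s sP] := choice fS.
exists s.
  apply: homo_ltn; first exact: ltn_trans.
  by move=> k; have [/[swap] _] := sP k.+1; have [_ [_ /[apply]] []] := sP k.
move=> k.
have fA j : (f k).1 `<=` [set t | (j < k)%N -> A (s j) t].
  elim: k => [//|k IH] t; have [_ [-> _]] := sP k => -[/IH ft At] /=.
  by rewrite ltnS leq_eqVlt => /predU1P[->|].
have [[uN [e e0 eN]] _] := fP k.
have [n _ /eN] := uN 0%N.
have [[t [ft _]] _|/forallNP f0] := pselect (exists t, ((f k).1 `&` A n) t).
  by exists t => j; exact: fA.
rewrite (_ : _ `&` _ = set0); last by apply/seteqP; split => // t /f0.
by rewrite indic0 (mean_cst LP) leNgt e0.
Qed.

End FiniteIntersection.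

Lemma cvg0_unbounded (R : realType) (a : nat -> R) :
  (forall e, 0 < e -> ~ unbounded_nat [set n | e <= `|a n|]) -> a @ \oo --> 0.
Proof.
move=> H; apply/cvgrPdist_lt => e /H /existsNP[N HN]; exists N.+1 => // n /= Nn.
rewrite sub0r normrN ltNge; apply/negP => en; apply: HN.
by exists n.
Qed.

Lemma cvg0_not_unbounded (R : realType) (a : nat -> R) e :
  a @ \oo --> 0 -> 0 < e -> ~ unbounded_nat [set n | e <= `|a n|].
Proof.
move=> /cvgrPdist_lt H /H [N _ HN] /(_ N)[n Nn /=].
rewrite leNgt => /negP; apply.
by have := HN n (ltnW Nn); rewrite sub0r normrN.
Qed.

(* The bounded convergence theorem, in the only form available for a finitely
   additive mean: pointwise convergence at ultrafilter points of [T]. *)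
Lemma mean_weakly_null (R : realType) (F : normedModType R[i]) (T : Type)
    (L : (T -> R) -> R) (g : T -> F -> R) (w : nat -> F) :
  mean L -> (forall t, dball (g t)) ->
  (forall h, dball h -> h \o w @ \oo --> 0) ->
  (fun n => L (fun t => `|g t (w n)|)) @ \oo --> 0.
Proof.
move=> LP gB w0; apply: cvg0_unbounded => e e0 /increasing_seq_in[s1 s1I s1e].
have [M Mw] : exists M : R, forall h n, dball h -> `|h (w n)| <= M.
  apply: dball_uniform_boundedness => h /w0 h0.
  have : cvgn (fun n => h (w n)) by apply/cvg_ex; exists 0.
  move=> /cvg_seq_bounded[M0 [_ /(_ (M0 + 1))]] HM.
  by exists (M0 + 1) => n; apply: HM => //; rewrite ltrDl.
have bg n : bfun (fun t => `|g t (w n)|) by apply/bfun_abs/bfun_dball.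
pose M1 := `|M| + 1.
have M10 : 0 < M1 by rewrite ltr_wpDl.
(* Markov's inequality: [|g t (w (s1 n))|] is bounded by [M1] and has mean at least [e], so the set
   where it reaches [e / 2] has mean at least [e / 2 / M1]. *)
pose A n := [set t | e / 2 <= `|g t (w (s1 n))|].
have [||s2 s2I s2A] := @finite_intersection_subsequence _ _ L LP A (e / 2 / M1).
- by rewrite !divr_gt0.
- move=> n; have := s1e n; rewrite /= ger0_norm; last first.
    by apply: (mean_ge_cst LP).
  move=> eL; have bA : bfun (fun t => M1 * \1_(A n) t : R).
    by apply: bfunM; [exact: bfun_cst|exact: bfun_indic].
  have : L (fun t => `|g t (w (s1 n))|) <= L (fun t => M1 * \1_(A n) t + e / 2).
    apply: (mean_le LP) => //; first by apply: bfunD => //; exact: bfun_cst.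
    move=> t; rewrite indicE; have [tA|tA] := boolP (t \in A n).
      rewrite mulr1 (le_trans (Mw _ _ (gB t)))// (le_trans (ler_norm _))//.
      by rewrite /M1 -addrA lerDl addr_ge0// divr_ge0// ltW.
    move: tA; rewrite notin_setE /A/= => /negP.
    by rewrite -ltNge => /ltW; rewrite mulr0 add0r.
  rewrite (meanD LP) ?(meanZ LP) ?(mean_cst LP)//;
    try exact: bfun_cst; try exact: bfun_indic.
  by rewrite ler_pdivrMr// mulrC; lra.
have [t tP] := choice s2A.
(* Since [t k] lies in the first [k] chosen sets, the limit functional stays at least [e / 2] in
   modulus along the subsequence, against weak nullity. *)
have hB : dball (fun x => ulim (fun k => g (t k) x)) by exact: ulim_dball.
have e2 : 0 < e / 2 by rewrite divr_gt0.
apply: (cvg0_not_unbounded (w0 _ hB) e2) => n.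
have ge_id (s : nat -> nat) k : {homo s : m n / (m < n)%N} -> (k <= s k)%N.
  by move=> sI; elim: k => // k IH; apply: leq_ltn_trans IH _; exact: sI.
exists (s1 (s2 n.+1)) => /=.
  by rewrite (leq_trans (ge_id _ _ s2I))// ge_id.
have bt : bfun (fun k => g (t k) (w (s1 (s2 n.+1)))).
  by apply: (@bfun_dball _ _ _ (fun k => g (t k))).
rewrite -ulim_abs// -[leLHS](mean_cst (@ulim_mean R)); apply: ulim_near_le.
- exact: bfun_cst.
- exact: bfun_abs.
(* [tP] at [k] covers only indices below [k], hence [n.+2] for the index [n.+1]. *)
- by exists n.+2 => // k /= nk; exact: tP.
Qed.

(** * The space of bounded sequences *)

Section BoundedSequences.
Variable R : realType.

Definition linf_pred : {pred (nat -> R[i]^o)} :=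
  mem [set f : nat -> R[i]^o | bfun (fun n => rnorm (f n))].

(** Complex l^infinity, the codomain of the Rademacher operator. That the real parts of the
    coordinates of each value tend to 0 comes separately, from [rademacher_coef_cvg0]. *)
Record linf := Linf { linf_fun :> nat -> R[i]^o; linfP : linf_fun \in linf_pred }.

HB.instance Definition _ := [isSub for linf_fun].
HB.instance Definition _ := [Choice of linf by <:].

Lemma linf_pred_closed : GRing.submod_closed linf_pred.
Proof.
split; first by apply/mem_set; exists 0 => n; rewrite rnorm0 normr0.
move=> a f g /set_mem/= [M fM] /set_mem/= [N gN]; apply/mem_set => /=.
exists (complex.Re `|a| * M + N) => n.
rewrite ger0_norm ?rnorm_ge0// (le_trans (rnormD _ _))//.
rewrite rnormZ lerD//; last by rewrite (le_trans _ (gN n))// ler_norm.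
rewrite ler_wpM2l//; first by rewrite -ler0c RRe_real ?normr_real.
by rewrite (le_trans _ (fM n))// ler_norm.
Qed.

HB.instance Definition _ :=
  GRing.isSubmodClosed.Build R[i] (nat -> R[i]^o) linf_pred linf_pred_closed.
HB.instance Definition _ := [SubChoice_isSubLmodule of linf by <:].

Lemma linfD (f g : linf) n : (f + g) n = f n + g n. Proof. by []. Qed.
Lemma linfZ a (f : linf) n : (a *: f) n = a *: f n. Proof. by []. Qed.
Lemma linfN (f : linf) n : (- f) n = - f n. Proof. by []. Qed.

Definition linf_norm (f : linf) : R := sup (range (fun n => rnorm (f n))).

Lemma linf_has_sup (f : linf) : has_sup (range (fun n => rnorm (f n))).
Proof.
have /set_mem[M fM] := linfP f; split; first by exists (rnorm (f 0%N)), 0%N.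
by exists M => _ [n _ <-]; rewrite (le_trans _ (fM n))// ler_norm.
Qed.

Lemma linf_norm_ge (f : linf) n : rnorm (f n) <= linf_norm f.
Proof. by apply: sup_upper_bound; [exact: linf_has_sup|exists n]. Qed.

Lemma linf_norm_le (f : linf) M : (forall n, rnorm (f n) <= M) -> linf_norm f <= M.
Proof.
move=> fM; apply: ge_sup => [|_ [n _ <-]//]; by have [] := linf_has_sup f.
Qed.

Lemma linf_normD (f g : linf) :
  (linf_norm (f + g))%:C <= (linf_norm f)%:C + (linf_norm g)%:C.
Proof.
rewrite -rmorphD lecR; apply: linf_norm_le => n.
by rewrite linfD (le_trans (rnormD _ _))// lerD// linf_norm_ge.
Qed.

Lemma linf_normZ a (f : linf) : (linf_norm (a *: f))%:C = `|a| * (linf_norm f)%:C.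
Proof.
rewrite -[`|a|](RRe_real (normr_real a)) -rmorphM; congr (_%:C).
have a0 : 0 <= complex.Re `|a| by rewrite -ler0c RRe_real ?normr_real.
apply/eqP; rewrite eq_le; apply/andP; split.
  by apply: linf_norm_le => n; rewrite linfZ rnormZ ler_wpM2l// linf_norm_ge.
have := a0; rewrite le0r => /orP[/eqP->|a1].
  by rewrite mul0r (le_trans (rnorm_ge0 _) (linf_norm_ge _ 0%N)).
rewrite mulrC -ler_pdivlMr//; apply: linf_norm_le => n.
by rewrite ler_pdivlMr// mulrC -rnormZ -linfZ linf_norm_ge.
Qed.

Lemma linf_norm0_eq0 (f : linf) : (linf_norm f)%:C = 0 -> f = 0.
Proof.
move=> [f0]; apply: val_inj; apply/funext => n /=; apply: rnorm0_eq0.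
by apply/eqP; rewrite eq_le rnorm_ge0 -f0 linf_norm_ge.
Qed.

HB.instance Definition _ := Lmodule_isNormed.Build R[i] linf
  linf_normD linf_normZ linf_norm0_eq0.

Lemma rnorm_linf (f : linf) : rnorm f = linf_norm f.
Proof. by []. Qed.

Lemma linf_complete (G : set_system linf) : ProperFilter G -> cauchy G -> cvg G.
Proof.
move=> GF Gc.
have Ge (e : R) : 0 < e -> exists f : linf, G [set g | rnorm (f - g) < e].
  move=> e0; have /cauchyP/(_ e%:C) := Gc; rewrite ltcR => /(_ e0)[f fG].
  exists f; apply: filterS fG => g; rewrite -ball_normE.
  by rewrite /= norm_rnormE ltcR.
have cvgc (p : linf -> R) : (forall f g, `|p f - p g| <= rnorm (f - g)) -> cvg (p @ G).
  move=> pl; apply: cauchy_cvg; apply/cauchy_exP => e /Ge[f fG].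
  exists (p f); rewrite -[_ (ball _ _)]/(G (p @^-1` ball (p f) e)).
  apply: filterS fG => g fg; rewrite -(@ball_normE R R).
  exact: le_lt_trans (pl f g) fg.
have cRe n : cvg ((fun f : linf => complex.Re (f n)) @ G).
  apply: cvgc => f g; apply: le_trans (linf_norm_ge _ n).
  rewrite linfD linfN; apply: le_trans (rnormC_Re _).
  by case: (f n) (g n) => [? ?] [? ?].
have cIm n : cvg ((fun f : linf => complex.Im (f n)) @ G).
  apply: cvgc => f g; apply: le_trans (linf_norm_ge _ n).
  rewrite linfD linfN; apply: le_trans (rnormC_Im _).
  by case: (f n) (g n) => [? ?] [? ?].
pose l n : R[i]^o := lim ((fun f : linf => complex.Re (f n)) @ G) +i*
                     lim ((fun f : linf => complex.Im (f n)) @ G).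
have ln n (f : linf) e : G [set g | rnorm (f - g) < e] -> rnorm (l n - f n) <= e + e.
  move=> fG; have fn (g : linf) : rnorm (f - g) < e -> rnorm (f n - g n) <= e.
    by move=> /ltW; apply: le_trans; rewrite rnorm_linf -linfN -linfD linf_norm_ge.
  rewrite rnormBC (le_trans (rnormC_le _))//.
  have rb (p : R[i]^o -> R) : (forall z w, p (z - w) = p z - p w) ->
      (forall z, `|p z| <= rnorm z) -> cvg ((fun f : linf => p (f n)) @ G) ->
      `|p (f n) - lim ((fun f : linf => p (f n)) @ G)| <= e.
    move=> pB ple pc; rewrite distrC ler_distl; apply/andP; split.
      apply: limr_ge => //; apply: filterS fG => g /fn/(le_trans (ple _)).
      by rewrite pB; rewrite ler_distl => /andP[? ?]; lra.
    apply: limr_le => //; apply: filterS fG => g /fn/(le_trans (ple _)).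
    by rewrite pB; rewrite ler_distl => /andP[? ?]; lra.
  apply: lerD.
    have := rb (@complex.Re R); rewrite /l; case: (f n) => a b /=; apply => //.
      by move=> [? ?] [? ?].
    exact: rnormC_Re.
  have := rb (@complex.Im R); rewrite /l; case: (f n) => a b /=; apply => //.
    by move=> [? ?] [? ?].
  exact: rnormC_Im.
have lP : l \in linf_pred.
  apply/mem_set; have [f f1] := Ge 1 ltr01; exists (1 + 1 + rnorm f) => n.
  rewrite ger0_norm ?rnorm_ge0// -[X in rnorm X](subrK (f n)).
  by rewrite (le_trans (rnormD _ _))// lerD ?ln// linf_norm_ge.
apply/cvg_ex; exists (Linf lP); apply/cvg_rnormP => e e0.
(* Two quarters come from [ln], one for each of the real and imaginary parts, and a third from the
   distance between [f] and [g]. *)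
have e4 : 0 < e / 4 by rewrite divr_gt0.
have [f fG] := Ge _ e4; apply: filterS (fG) => g fg.
rewrite -(subrKA f) (le_lt_trans (rnormD _ _))//.
rewrite (@le_lt_trans _ _ (e / 4 + e / 4 + e / 4))//; last by lra.
rewrite lerD//; last exact: ltW.
by apply: linf_norm_le => n; rewrite linfD linfN /= ln.
Qed.

HB.instance Definition _ := Uniform_isComplete.Build linf linf_complete.

End BoundedSequences.

(** * The Rademacher operator *)

Section CubeMean.
Variable R : realType.
Implicit Types (h : nat * (nat -> bool) -> R) (N k : nat).

(** Padding by [false] places the vertices of cubes of all dimensions in one domain, so that a
    single [h] can be averaged over each cube. *)
Definition ext_ffun N (sg : {ffun 'I_N -> bool}) (n : nat) : bool :=
  if insub n is Some i then sg i else false.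

Lemma ext_ffunE N (sg : {ffun 'I_N -> bool}) n (nN : (n < N)%N) :
  ext_ffun sg n = sg (Ordinal nN).
Proof. by rewrite /ext_ffun insubT. Qed.

Lemma ext_ffun_out N (sg : {ffun 'I_N -> bool}) n : (N <= n)%N ->
  ext_ffun sg n = false.
Proof. by move=> nN; rewrite /ext_ffun insubN// -leqNgt. Qed.

Definition cube_avg h N : R :=
  (\sum_(sg : {ffun 'I_N -> bool}) h (N, ext_ffun sg)) / (2 ^ N)%:R.

(* A point [(N, sg)] stands for the vertex of the cube [{0,1}^N] given by the
   first [N] values of [sg]. *)
Definition cube_mean h : R := ulim (cube_avg h).

Lemma cube_avg_le h h' N :
  (forall sg, h (N, sg) <= h' (N, sg)) -> cube_avg h N <= cube_avg h' N.
Proof. by move=> hh'; rewrite ler_wpM2r// ler_sum. Qed.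

Lemma cube_avg_cst c N : cube_avg (fun=> c) N = c.
Proof.
rewrite /cube_avg sumr_const card_ffun card_bool card_ord -[_ *+ _]mulr_natr.
by rewrite mulfK// pnatr_eq0 expn_eq0.
Qed.

Lemma cube_avgZ c h N : cube_avg (fun t => c * h t) N = c * cube_avg h N.
Proof. by rewrite /cube_avg -mulr_sumr -mulrA. Qed.

Lemma bfun_cube_avg h : bfun h -> bfun (cube_avg h).
Proof.
move=> [M hM]; exists M => N; rewrite ler_norml -(cube_avg_cst (- M) N).
rewrite -[X in _ && (_ <= X)](cube_avg_cst M N).
by rewrite !cube_avg_le// => sg; have := hM (N, sg); rewrite ler_norml => /andP[].
Qed.

Lemma cube_mean_near_le h h' N0 : bfun h -> bfun h' ->
  (forall N sg, (N0 <= N)%N -> h (N, sg) <= h' (N, sg)) ->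
  cube_mean h <= cube_mean h'.
Proof.
move=> bh bh' hh'; apply: ulim_near_le; [exact: bfun_cube_avg..|].
by exists N0 => // N /= ?; apply: cube_avg_le => sg; exact: hh'.
Qed.

Lemma cube_mean_mean : mean cube_mean.
Proof.
split=> [f g bf bg|c f bf|f g bf bg fg|]; rewrite /cube_mean.
- rewrite -(meanD (@ulim_mean R)) ?bfun_cube_avg//; try exact: bfun_cube_avg.
  congr ulim; apply/funext => N.
  by rewrite /cube_avg -mulrDl -big_split.
- rewrite -(meanZ (@ulim_mean R)); last exact: bfun_cube_avg.
  by congr ulim; apply/funext => N; rewrite cube_avgZ.
- by apply: (@cube_mean_near_le _ _ 0%N) => // *; exact: fg.
- rewrite (_ : cube_avg _ = fun=> 1) ?(mean_cst (@ulim_mean R))//.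
  by apply/funext => N; rewrite cube_avg_cst.
Qed.

Definition flip (k : nat) (sg : nat -> bool) (n : nat) : bool :=
  if n == k then ~~ sg n else sg n.

(** Flipping coordinate [k] permutes the vertices of each cube of dimension [N > k], so these
    averages vanish. The finitely many smaller cubes do not affect the ultrafilter limit. *)
Lemma cube_mean_odd k h : bfun h ->
  (forall N sg, h (N, flip k sg) = - h (N, sg)) -> cube_mean h = 0.
Proof.
move=> bh hodd.
have h0 N : (k < N)%N -> cube_avg h N = 0.
  move=> kN; pose fl (sg : {ffun 'I_N -> bool}) : {ffun 'I_N -> bool} :=
    [ffun i : 'I_N => if val i == k then ~~ sg i else sg i].
  have flK : involutive fl.
    by move=> sg; apply/ffunP => i; rewrite !ffunE; case: eqP => // _; rewrite negbK.
  have ext_fl ta : ext_ffun (fl ta) = flip k (ext_ffun ta).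
    apply/funext => n; rewrite /flip; have [nN|nN] := ltnP n N.
      by rewrite !(ext_ffunE _ nN) ffunE.
    rewrite !ext_ffun_out//; case: eqP => // nk.
    by rewrite nk leqNgt kN in nN.
  suff : \sum_(ta : {ffun 'I_N -> bool}) h (N, ext_ffun ta) =
      - \sum_(ta : {ffun 'I_N -> bool}) h (N, ext_ffun ta).
    rewrite /cube_avg; move: (\sum_(_ : _) _) => S S0.
    by rewrite (_ : S = 0) ?mul0r//; lra.
  rewrite -sumrN {1}(reindex_inj (inv_inj flK)) /=.
  by apply: eq_bigr => ta _; rewrite ext_fl hodd.
apply: ulim_eq; apply: cvg_near_cst; apply: ultra_nat_eventually.
by exists k.+1 => // N /= /h0 ->.
Qed.

Definition rademacher k (t : nat * (nat -> bool)) : R := if t.2 k then 1 else -1.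

Lemma rademacher_norm k t : `|rademacher k t| = 1.
Proof. by rewrite /rademacher; case: (t.2 k); rewrite ?normrN normr1. Qed.

Lemma bfun_rademacher k : bfun (rademacher k).
Proof. by exists 1 => t; rewrite rademacher_norm. Qed.

Lemma rademacher_flip k j N sg :
  rademacher k (N, flip j sg) = (if k == j then -1 else 1) * rademacher k (N, sg).
Proof.
by rewrite /rademacher /flip /=; case: (k == j); case: (sg k) => /=; ring.
Qed.

Lemma cube_mean_rademacher k : cube_mean (rademacher k) = 0.
Proof.
apply: (@cube_mean_odd k); first exact: bfun_rademacher.
by move=> N sg; rewrite rademacher_flip eqxx mulN1r.
Qed.

Lemma cube_mean_rademacherM k j : k != j ->
  cube_mean (fun t => rademacher k t * rademacher j t) = 0.
Proof.
move=> kj; apply: (@cube_mean_odd k); first by apply: bfunM; exact: bfun_rademacher.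
by move=> N sg; rewrite !rademacher_flip eqxx eq_sym (negbTE kj) mulN1r mul1r mulNr.
Qed.

End CubeMean.

(** * Bessel's inequality and complete continuity of the operator *)

Section RademacherOperator.
Variables (R : realType) (F : normedModType R[i]).
Variable g : nat * (nat -> bool) -> F -> R.
Hypothesis gB : forall t, dball (g t).
Let L := @cube_mean R.
Let LP : mean L := @cube_mean_mean R.
Let r := @rademacher R.

Definition rademacher_coef k (x : F) : R :=
  cube_mean (fun t => rademacher R k t * g t x).

Let psi := rademacher_coef.

Lemma rademacher_coef_dball k : dball (rademacher_coef k).
Proof.
by apply: (mean_dball LP) => // t; rewrite rademacher_norm.
Qed.

Let bg x : bfun (fun t => g t x). Proof. exact: bfun_dball. Qed.

Lemma rademacher_coef_le k x :
  `|rademacher_coef k x| <= cube_mean (fun t => `|g t x|).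
Proof.
have b : bfun (fun t => r k t * g t x).
  by apply: bfunM; [exact: bfun_rademacher|exact: bg].
apply: le_trans (mean_norm_le LP b) _; apply: (mean_le LP).
- exact: bfun_abs.
- exact/bfun_abs/bg.
- by move=> t; rewrite normrM rademacher_norm mul1r.
Qed.

(** The Rademacher functions are orthonormal for the form [L (f h)]; [D K] is what remains of
    [g t x] after its first [K] projections are subtracted. *)
Lemma bessel (x : F) K : \sum_(k < K) psi k x ^+ 2 <= rnorm x ^+ 2.
Proof.
pose c k := psi k x.
pose S K t := \sum_(k < K) c k * r k t.
have br k : bfun (r k) by exact: bfun_rademacher.
have bcr k : bfun (fun t => c k * r k t) by apply: bfunM => //; exact: bfun_cst.
have bS K' : bfun (S K').
  by have [] := mean_sum LP K' bcr.
pose D K t := g t x - S K t.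
have bD K' : bfun (D K') by apply: bfunD; [exact: bg|exact: bfunN].
have bDD K' : bfun (fun t => D K' t * D K' t) by exact: bfunM.
have LrS K' : L (fun t => r K' t * S K' t) = 0.
  rewrite (_ : (fun t => _) = fun t => \sum_(k < K') c k * (r K' t * r k t)); last first.
    by apply/funext => t; rewrite mulr_sumr; apply: eq_bigr => k _; rewrite mulrCA.
  have brr k : bfun (fun t => r K' t * r k t) by exact: bfunM.
  have [|_ ->] := mean_sum LP K' (f := fun k t => c k * (r K' t * r k t)).
    by move=> k; apply: bfunM => //; exact: bfun_cst.
  rewrite big1// => k _; rewrite (meanZ LP)// [L _]cube_mean_rademacherM ?mulr0//.
  by rewrite gtn_eqF.
(* [S K'] involves only [r k] with [k < K'], so the remainder keeps the [K']-th coefficient of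
   [g]. *)
have LrD K' : L (fun t => r K' t * D K' t) = c K'.
  rewrite (_ : (fun t => _) = fun t => r K' t * g t x + - (r K' t * S K' t)); last first.
    by apply/funext => t; rewrite mulrBr.
  rewrite (meanD LP) ?(meanN LP) ?LrS ?subr0//; try exact: bfunM.
  by apply: bfunN; exact: bfunM.
have rr k t : r k t * r k t = 1.
  by rewrite /r /rademacher; case: (t.2 k); rewrite ?mulrNN mulr1.
(* Passing from [D K'] to [D K'.+1] lowers the mean square by exactly [c K' ^+ 2]. *)
have LD K' : L (fun t => D K' t * D K' t) + \sum_(k < K') c k ^+ 2 <= rnorm x ^+ 2.
  elim: K' => [|K' IH].
    rewrite big_ord0 addr0; apply: (mean_le_cst LP) => // t.
    rewrite /D /S big_ord0 subr0 -expr2 -real_normK ?num_real//.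
    by rewrite lerXn2r ?nnegrE ?rnorm_ge0// dball_norm.
  apply: le_trans IH; rewrite big_ord_recr /= addrA addrAC lerD2r.
  rewrite (_ : (fun t => D K'.+1 t * _) = fun t =>
     D K' t * D K' t + (- 2 * c K' * (r K' t * D K' t) + c K' ^+ 2)); last first.
    apply/funext => t; have -> : D K'.+1 t = D K' t - c K' * r K' t.
      by rewrite /D /S big_ord_recr /= opprD addrA.
    have -> : c K' ^+ 2 = c K' ^+ 2 * (r K' t * r K' t) by rewrite rr mulr1.
    ring.
  rewrite (meanD LP)//; last first.
    by apply: bfunD; [apply: bfunM; [exact: bfun_cst|exact: bfunM]|exact: bfun_cst].
  rewrite (meanD LP); [|by apply: bfunM; [exact: bfun_cst|exact: bfunM]|exact: bfun_cst].
  rewrite (meanZ LP); last exact: bfunM.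
  by rewrite (mean_cst LP) LrD; lra.
apply: le_trans (LD K); rewrite lerDr.
by apply: (mean_ge_cst LP) => // t; rewrite -expr2 sqr_ge0.
Qed.

Lemma rademacher_coef_cvg0 x : (fun k => rademacher_coef k x) @ \oo --> 0.
Proof.
have sq0 : (fun k => psi k x ^+ 2) @ \oo --> 0.
  apply: cvg_series_cvg_0; apply: nondecreasing_is_cvgn.
    apply: nondecreasing_series => n _ _; exact: sqr_ge0.
  by exists (rnorm x ^+ 2) => _ [n _ <-]; rewrite seriesEord; exact: bessel.
apply: cvg0_unbounded => e e0 u.
have e20 : 0 < e ^+ 2 by rewrite exprn_gt0.
apply: (cvg0_not_unbounded sq0 e20); apply: sub_unbounded_nat u => k /= ek.
by rewrite normrX lerXn2r// nnegrE ltW.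
Qed.

Let opfun (x : F) : nat -> R[i]^o := fun k => cplx (rademacher_coef_dball k) x.

Lemma opfun_le x k : rnorm (opfun x k) <=
  cube_mean (fun t => `|g t x|) + cube_mean (fun t => `|g t ('i *: x)|).
Proof.
apply: le_trans (rnorm_cplx_le (rademacher_coef_dball k) x) _.
by apply: lerD; exact: rademacher_coef_le.
Qed.

Lemma opfun_linf x : opfun x \in @linf_pred R.
Proof.
apply/mem_set; eexists => k; rewrite ger0_norm ?rnorm_ge0//; exact: opfun_le.
Qed.

Definition rademacher_op (x : F) : linf R := Linf (opfun_linf x).

Lemma rademacher_op_linear : linear rademacher_op.
Proof.
move=> a x y; apply: val_inj; apply/funext => k.
exact: (cplx_is_linear (rademacher_coef_dball k)).
Qed.

HB.instance Definition _ :=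
  GRing.isLinear.Build R[i] F (linf R) _ rademacher_op rademacher_op_linear.

Lemma rademacher_op_le x : rnorm (rademacher_op x) <=
  cube_mean (fun t => `|g t x|) + cube_mean (fun t => `|g t ('i *: x)|).
Proof. by apply: linf_norm_le => k; exact: opfun_le. Qed.

Lemma Re_rademacher_op x k : complex.Re (rademacher_op x k) = rademacher_coef k x.
Proof. by []. Qed.

(** By [rademacher_op_le] the image of [w] is controlled by the means of [|g t w|] and
    [|g t (i w)|], and both vanish along weakly null sequences by [mean_weakly_null]. *)
Lemma rademacher_op_completely_continuous : completely_continuous rademacher_op.
Proof.
split.
  apply: (@bounded_rnorm_continuous _ _ _ rademacher_op 2) => x.
  rewrite (le_trans (rademacher_op_le _))// mulr_natl mulr2n lerD//.
    by apply: (mean_le_cst LP); [exact/bfun_abs/bg|move=> t; exact: dball_norm].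
  apply: (mean_le_cst LP); first exact/bfun_abs/bg.
  by move=> t; rewrite -[leRHS]rnormZi dball_norm.
move=> u [l ul]; apply/cvg_ex; exists (rademacher_op l).
pose w n := l - u n.
have w0 h : dball h -> h \o w @ \oo --> 0.
  move=> hB; rewrite (_ : h \o w = fun n => h l - h (u n)); last first.
    by apply/funext => n /=; rewrite dballB.
  by rewrite -(subrr (h l)); apply: cvgB; [exact: cvg_cst|exact: weakly_cvg_dball].
have wi0 h : dball h -> h \o (fun n => 'i *: w n) @ \oo --> 0.
  by move=> hB; exact: (w0 _ (dball_i hB)).
have H : (fun n => L (fun t => `|g t (w n)|) + L (fun t => `|g t ('i *: w n)|))
    @ \oo --> (0 : R).
  by rewrite -[X in _ --> X](addr0 0); apply: cvgD;
    [exact: mean_weakly_null LP gB w0|exact: mean_weakly_null LP gB wi0].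
apply/cvg_rnormP => e e0; move/cvgrPdist_lt/(_ e e0): H; apply: filterS => n.
rewrite /= sub0r normrN => H; rewrite -linearB; apply: le_lt_trans (rademacher_op_le _) _.
exact: le_lt_trans (ler_norm _) H.
Qed.

(** On cubes with [N > k] both signs give [r k t * g t (x k) >= (b - a) / 2 + (a + b) / 2 * r k t],
    and [r k] has mean zero. *)
Lemma rademacher_coef_ge (a b : R) (x : nat -> F) k :
  (forall N sg j, (j < N)%N ->
     if sg j then b <= g (N, sg) (x j) else g (N, sg) (x j) <= a) ->
  (b - a) / 2 <= rademacher_coef k (x k).
Proof.
move=> gx; have br : bfun (r k) by exact: bfun_rademacher.
have bc c : bfun (fun _ : nat * (nat -> bool) => c : R) by exact: bfun_cst.
have bcr : bfun (fun t => (a + b) / 2 * r k t) by exact: bfunM.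
rewrite -[leLHS](_ : L (fun t => (b - a) / 2 + (a + b) / 2 * r k t) = _); last first.
  rewrite (meanD LP)// (mean_cst LP) (meanZ LP)//.
  by rewrite [L _]cube_mean_rademacher mulr0 addr0.
apply: (@cube_mean_near_le _ _ _ k.+1).
- exact: bfunD.
- by apply: bfunM; [exact: bfun_rademacher|exact: bg].
- move=> N sg kN; have := gx N sg k kN; rewrite /r /rademacher /=.
  by case: (sg k); lra.
Qed.

End RademacherOperator.

(* The image of [x] clusters nowhere: each value of the operator lies in c_0,
   but the k-th coordinate of the image of [x k] stays away from 0. *)
Lemma rademacher_op_not_precompact (R : realType) (F : normedModType R[i])
    (x : nat -> F) (a b : R) : a < b ->
  (forall k (sg : nat -> bool), exists2 g, dball g &
    forall j, (j < k)%N -> if sg j then b <= g (x j) else g (x j) <= a) ->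
  exists (T : {linear F -> linf R}), completely_continuous T /\
    forall A : set (linf R), (forall k, A (T (x k))) -> ~ compact A.
Proof.
move=> ab /(_ _ _)/cid2 gx.
pose g (t : nat * (nat -> bool)) := projT1 (gx t.1 t.2).
have gB t : dball (g t) by rewrite /g; case: (gx t.1 t.2).
have gab N sg j : (j < N)%N ->
    if sg j then b <= g (N, sg) (x j) else g (N, sg) (x j) <= a.
  by rewrite /g /=; case: (gx N sg) => /= ? _; exact.
exists (rademacher_op gB); split; first exact: rademacher_op_completely_continuous.
move=> A AT cA; pose u k := rademacher_op gB (x k).
have d0 : 0 < (b - a) / 2 by rewrite divr_gt0// subr_gt0.
(* The [k]-th coefficient at [x k] is at least [4 d]. Passing through [y] to the image of [x j]
   costs less than [2 d], and the coefficient there is below [d]. *)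
pose d := (b - a) / 2 / 4; have d40 : 0 < d by rewrite divr_gt0.
have [|y [Ay yc]] := cA (u @ \oo) _; first by exists 0%N => // k _; exact: AT.
pose B := [set z : linf R | rnorm (y - z) < d].
have yB : nbhs y B.
  have /cvg_rnormP/(_ d d40) : (fun z : linf R => z) @ y --> y by exact: cvg_id.
  exact.
have often m : exists2 k, (m < k)%N & B (u k).
  have [|z [[k mk <-] Bz]] := yc [set u k | k in [set k | (m < k)%N]] B _ yB.
    by exists m.+1 => // k /= mk; exists k.
  by exists k.
(* First [j] is fixed, then [k] is taken so far out that the [k]-th coefficient at [x j] is
   small. *)
have [j _ Bj] := often 0%N.
have /cvgrPdist_lt/(_ d d40)[m _ mP] := rademacher_coef_cvg0 gB (x j).
have [k mk Bk] := often m.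
have := mP k (ltnW mk); rewrite sub0r normrN -Re_rademacher_op.
have := @rademacher_coef_ge _ _ g gB a b x k gab; rewrite -Re_rademacher_op.
have coord (f h : linf R) : `|complex.Re (f k) - complex.Re (h k)| <= rnorm (f - h).
  apply: le_trans (linf_norm_ge _ k); rewrite linfD linfN.
  apply: le_trans (rnormC_Re _); by case: (f k) (h k) => [? ?] [? ?].
have := le_lt_trans (coord _ _) Bk; have := le_lt_trans (coord _ _) Bj.
rewrite !ltr_norml => /andP[? ?] /andP[? ?] ? /andP[? ?].
have d4 : 4 * d = (b - a) / 2 by rewrite /d mulrC divfK.
rewrite -d4 /u in d0 *; lra.
Qed.

(** * Rosenthal's dichotomy *)

(** [sup S] is the limit superior. Falling below [sup S - e] infinitely often would make [y]
    oscillate across two rationals in between. *)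
Lemma nonoscillating_cvg (R : realType) (y : nat -> R) : bfun y ->
  (forall a b : rat, a < b ->
     ~ (unbounded_nat [set n | ratr b <= y n] /\
        unbounded_nat [set n | y n <= ratr a])) -> cvgn y.
Proof.
move=> [M yM] osc.
pose S := [set a : R | unbounded_nat [set n | a <= y n]].
have yMM n : - M <= y n <= M by rewrite -ler_norml.
have Sub : ubound S M.
  by move=> a /(_ 0%N)[n _ /= /le_trans]; apply; have /andP[] := yMM n.
have SM : S (- M) by move=> n; exists n.+1 => //=; have /andP[] := yMM n.+1.
have Ssup : has_sup S by split; [exists (- M)|exists M].
apply/cvg_ex; exists (sup S); apply/cvgrPdist_lt => e e0.
have /existsNP[N1 HN1] : ~ S (sup S + e).
  by move=> /(ub_le_sup Ssup.2); rewrite gerDl leNgt e0.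
have /existsNP[N2 HN2] : ~ unbounded_nat [set n | y n <= sup S - e].
  move=> u; have [c Sc ec] := sup_adherent e0 Ssup.
  have /rat_in_itvoo[b] := ec; rewrite in_itv /= => /andP[eb bc].
  have /rat_in_itvoo[a] := eb; rewrite in_itv /= => /andP[ea ab].
  rewrite ltr_rat in ab; apply: (osc _ _ ab); split.
    by apply: sub_unbounded_nat Sc => n /=; exact/le_trans/ltW.
  by apply: sub_unbounded_nat u => n /= /le_trans; apply; exact: ltW.
exists (maxn N1 N2).+1 => // n /=; rewrite gtn_max => /andP[n1 n2].
rewrite distrC ltr_distl; apply/andP; split; rewrite ltNge; apply/negP => yn.
  by apply: HN2; exists n.
by apply: HN1; exists n.
Qed.

(** Either some rational pair stays unsettled under every thinning of some infinite index set, and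
    [independent_subsequence] applies, or diagonalising over the countably many pairs leaves a
    subsequence along which no functional oscillates. *)
Lemma rosenthal_dichotomy (R : realType) (F : normedModType R[i])
    (x : nat -> F) (M : R) : (forall n, rnorm (x n) <= M) ->
  (exists2 s : nat -> nat, {homo s : m n / (m < n)%N} & weakly_cauchy (x \o s)) \/
  (exists2 s : nat -> nat, {homo s : m n / (m < n)%N} &
   exists a b : R, a < b /\ forall k (sg : nat -> bool), exists2 g, dball g &
     forall j, (j < k)%N -> if sg j then b <= g (x (s j)) else g (x (s j)) <= a).
Proof.
move=> xM.
pose C (a b : rat) (c : bool) (n : nat) : set (F -> R) :=
  [set g | if c then ratr b <= g (x n) else g (x n) <= ratr a].
have [[a [b [L [ab uL nL]]]]|none] := pselect (exists a b L,
  [/\ a < b, unbounded_nat L & forall N, N `<=` L -> unbounded_nat N ->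
      ~ settles (C a b) N (@dball R F)]).
  right; have [s sI [_ sP]] := independent_subsequence uL nL.
  exists s => //; exists (ratr a), (ratr b); split; first by rewrite ltr_rat.
  by move=> k sg; have [g gB gC] := sP k sg; exists g => // j /gC.
(* Pairs of rationals are enumerated by [unpickle]; a number coding no pair imposes no condition. *)
left; pose Q k N := forall a b : rat, unpickle k = Some (a, b) -> a < b ->
  settles (C a b) N (@dball R F).
have [k N _ uN|k N N' QN NN' a b kab ab||N [_ uN QN]] := @diagonal_subset Q setT.
- have [[a [b [kab ab]]]|nab] := pselect
    (exists a b : rat, unpickle k = Some (a, b) /\ a < b).
    apply: contrapT => H; apply: none; exists a, b, N; split => // N' N'N uN' sN'.
    by apply: H; exists N'; split => // a' b'; rewrite kab => -[<- <-].
  by exists N; split => // a b kab ab; case: nab; exists a, b.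
- exact: settles_almost_sub (QN a b kab ab) NN'.
- by move=> n; exists n.+1.
have [s sI sN] := increasing_seq_in uN; exists s => //.
apply: dball_weakly_cauchy => g gB; apply: nonoscillating_cvg.
  by exists M => n; rewrite (le_trans (dball_norm _ gB))//; exact: xM.
move=> a b ab [ub ua].
have us c : unbounded_nat [set n | C a b c (s n) g] ->
    unbounded_nat [set n | N n /\ C a b c n g].
  have ge_id k : (k <= s k)%N.
    by elim: k => // k IH; apply: leq_ltn_trans IH _; exact: sI.
  move=> u n; have [m nm Cm] := u n; exists (s m); last by split.
  exact: leq_trans nm (ge_id _).
by have [[]] := QN (pickle (a, b)) a b (pickleK _) ab g gB; apply; apply: us.
Qed.

Lemma rosenthal_of_completely_continuous (R : realType) (F : normedModType R[i])
    (A : set F) (M : R) : (forall x, A x -> rnorm x <= M) ->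
  (forall (T : {linear F -> linf R}), completely_continuous T ->
     compact (closure (T @` A))) ->
  rosenthal A.
Proof.
move=> AM AT u Au.
have [//|[s sI [a [b [ab gP]]]]] := rosenthal_dichotomy (fun n => AM _ (Au n)).
have [T [Tcc]] := @rademacher_op_not_precompact _ _ (u \o s) a b ab gP.
move=> /(_ (closure (T @` A)))[|]; last exact: AT.
by move=> k; apply: subset_closure; exists (u (s k)).
Qed.

(** * Norming functionals *)

Section HahnBanach.
Context {R : realType} {F : normedModType R[i]}.
Implicit Types (p : F -> R).

(** Homogeneity is an inequality for [t > 0] only, which passes easily to infima; [sublinearZ]
    recovers equality. *)
Definition sublinear p := [/\ forall x y, p (x + y) <= p x + p y,
  forall t x, 0 < t -> p (t%:C *: x) <= t * p x & forall x, p x <= rnorm x].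

Lemma sublinear_rnorm : sublinear (@rnorm R F).
Proof. by split=> [x y|t x t0|//]; rewrite ?rnormD// rnormZr gtr0_norm. Qed.

Lemma sublinear0 p : sublinear p -> p 0 = 0.
Proof.
move=> [_ pZ pn]; apply/eqP; rewrite eq_le -{1}(@rnorm0 _ F) pn/=.
by have := pZ 2 0; rewrite scaler0 ltr0n => /(_ isT); lra.
Qed.

Lemma sublinearZ p t x : sublinear p -> 0 <= t -> p (t%:C *: x) = t * p x.
Proof.
move=> pS; rewrite le0r => /orP[/eqP->|t0]; first by rewrite scale0r mul0r sublinear0.
have [_ pZ _] := pS; apply/eqP; rewrite eq_le pZ//=.
have := pZ t^-1 (t%:C *: x); rewrite invr_gt0 t0 scalerA -rmorphM mulVf ?gt_eqF// scale1r.
by move=> /(_ isT); rewrite ler_pdivlMl.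
Qed.

Lemma sublinear_geN p x : sublinear p -> - p (- x) <= p x.
Proof.
move=> pS; have [pD _ _] := pS; rewrite -subr_ge0 opprK.
by rewrite -(sublinear0 pS) -(subrr x) pD.
Qed.

(** Serves both for the infimum defining [tilt] and for lower bounds of chains in Zorn's lemma. *)
Lemma sublinear_inf (J : Type) (q : J -> F -> R) :
  (exists j, forall x, q j x <= rnorm x) ->
  (forall x, exists m, forall j, m <= q j x) ->
  (forall j k x y, exists l, q l (x + y) <= q j x + q k y) ->
  (forall j t x, 0 < t -> exists k, q k (t%:C *: x) <= t * q j x) ->
  sublinear (fun x => inf (range (q^~ x))) /\
  forall j x, inf (range (q^~ x)) <= q j x.
Proof.
move=> [j0 qn] qlb qD qZ.
have hi x : has_inf (range (q^~ x)).
  split; first by exists (q j0 x), j0.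
  by have [m mq] := qlb x; exists m => _ [j _ <-].
have infle j x : inf (range (q^~ x)) <= q j x.
  by apply: ge_inf; [exact: (hi x).2|exists j].
split => //; split=> [x y|t x t0|x]; last exact: le_trans (infle j0 x) (qn x).
  rewrite -lerBlDr; apply: lb_le_inf; first exact: (hi x).1.
  move=> _ [j _ <-]; rewrite lerBlDr -lerBlDl.
  apply: lb_le_inf; first exact: (hi y).1.
  move=> _ [k _ <-]; rewrite lerBlDl.
  by have [l ql] := qD j k x y; exact: le_trans (infle l _) ql.
rewrite -ler_pdivrMl//; apply: lb_le_inf; first exact: (hi x).1.
move=> _ [j _ <-]; rewrite ler_pdivrMl//.
by have [k qk] := qZ j t x t0; exact: le_trans (infle k _) qk.
Qed.

(** A sublinear functional below [p] whose value at [- y] is at most [- p y]. *)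
Definition tilt p y (x : F) : R :=
  inf (range (fun t : {t : R | 0 <= t} => p (x + (sval t)%:C *: y) - sval t * p y)).

Lemma tilt_sublinear p y : sublinear p -> sublinear (tilt p y) /\
  forall t x, 0 <= t -> tilt p y x <= p (x + t%:C *: y) - t * p y.
Proof.
move=> pS; have [pD pZ pn] := pS.
have [||||tS tle] := @sublinear_inf {t : R | 0 <= t}
  (fun t x => p (x + (sval t)%:C *: y) - sval t * p y).
- exists (exist _ 0 (lexx 0)) => x /=.
  by rewrite scale0r addr0 mul0r subr0.
- move=> x; exists (- p (- x)) => -[t t0] /=.
  rewrite -(sublinearZ y pS t0); have := pD (x + t%:C *: y) (- x).
  by rewrite addrAC subrr add0r; lra.
- move=> [t t0] [s s0] x z; exists (exist _ (t + s) (addr_ge0 t0 s0)) => /=.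
  have := pD (x + t%:C *: y) (z + s%:C *: y).
  rewrite addrACA -scalerDl -rmorphD; lra.
- move=> [t t0] s x s0; exists (exist _ (s * t) (mulr_ge0 (ltW s0) t0)) => /=.
  have := pZ s (x + t%:C *: y) s0; rewrite scalerDr scalerA -rmorphM; lra.
by split => // t x t0; exact: (tle (exist _ t t0)).
Qed.

(** Zorn's lemma for the reversed pointwise order: a nonempty chain is bounded below by [- rnorm x]
    at each [x], and its infimum is again sublinear. *)
Lemma minimal_sublinear (p0 : F -> R) : sublinear p0 ->
  exists2 p, sublinear p /\ (forall x, p x <= p0 x) &
    forall q, sublinear q -> (forall x, q x <= p x) -> forall x, p x <= q x.
Proof.
move=> p0S.
pose T := {p : F -> R | sublinear p /\ forall x, p x <= p0 x}.
pose r (p q : T) := `[< forall x, sval q x <= sval p x >].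
have [|||[p [pS pp0]] pmin] := @ZL_preorder T (exist _ p0 (conj p0S (fun=> lexx _))) r.
- by move=> p; apply/asboolP => x.
- move=> p q s /asboolP qp /asboolP sq; apply/asboolP => x.
  exact: le_trans (qp x).
- move=> A Atot; have [[a Aa]|A0] := pselect (exists a, A a); last first.
    by exists (exist _ p0 (conj p0S (fun=> lexx _))) => s As; case: A0; exists s.
  have [||||iS ile] := @sublinear_inf {a : T | A a} (fun a => sval (sval a)).
  + by exists (exist _ a Aa) => x /=; have [[_ _ +] _] := svalP a; exact.
  + move=> x; exists (- rnorm x) => -[[p [pS pp]] Ap] /=.
    apply: le_trans (sublinear_geN x pS); rewrite lerN2 -(rnormN x).
    by have [_ _] := pS; exact.
  + move=> [b Ab] [c Ac] x y.
    have [/asboolP bc|/asboolP cb] := Atot _ _ Ab Ac.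
      exists (exist _ c Ac) => /=; have [[cD _ _] _] := svalP c.
      by rewrite (le_trans (cD _ _))// lerD2r.
    exists (exist _ b Ab) => /=; have [[bD _ _] _] := svalP b.
    by rewrite (le_trans (bD _ _))// lerD2l.
  + move=> [b Ab] t x t0; exists (exist _ b Ab) => /=.
    by have [[_ bZ _] _] := svalP b; exact: bZ.
  have ip0 x : inf (range (fun a : {a : T | A a} => sval (sval a) x)) <= p0 x.
    exact: le_trans (ile (exist _ a Aa) x) ((svalP a).2 x).
  exists (exist (fun p => sublinear p /\ forall x, p x <= p0 x) _ (conj iS ip0)).
  by move=> s As; apply/asboolP => x; exact: (ile (exist _ s As)).
exists p => // q qS qp.
have qp0 x : q x <= p0 x by exact: le_trans (qp x) (pp0 x).
have /(_ _)/asboolP := pmin (exist _ q (conj qS qp0)).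
by apply; apply/asboolP.
Qed.

(* A minimal sublinear functional is linear, because its tilts are not smaller. *)
Lemma hahn_banach_norming (x0 : F) : exists2 g, dball g & g x0 = rnorm x0.
Proof.
(* Minimising below the tilt of the norm forces [p (- x0) <= - rnorm x0], so [p] attains the norm at
   [x0]. *)
have [tS tle] := tilt_sublinear x0 sublinear_rnorm.
have [p [pS pt] pmin] := minimal_sublinear tS.
have [pD pZ pn] := pS.
have padd x y : p (x + y) = p x + p y.
  apply/eqP; rewrite eq_le pD/=; have [qS qle] := tilt_sublinear y pS.
  have qp z : tilt p y z <= p z.
    by have := qle 0 z (lexx _); rewrite scale0r addr0 mul0r subr0.
  (* Minimality gives [p x <= tilt p y x], and [t = 1] bounds the latter by [p (x + y) - p y]. *)
  have := pmin _ qS qp x; have := qle 1 x ler01.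
  by rewrite scale1r mul1r; lra.
have pN x : p (- x) = - p x.
  by apply/eqP; rewrite -addr_eq0 -padd addNr (sublinear0 pS).
exists p.
  split => // t x; have [t0|t0] := leP 0 t; first exact: sublinearZ.
  have := @sublinearZ p (- t) x pS; rewrite oppr_ge0 (ltW t0) => /(_ isT).
  by rewrite rmorphN scaleNr pN mulNr => /oppr_inj.
apply/eqP; rewrite eq_le pn/=.
have := tle 1 (- x0) ler01; rewrite scale1r mul1r addNr rnorm0 sub0r.
by have := pt (- x0); rewrite pN; lra.
Qed.

End HahnBanach.

(** * Images of Rosenthal sets and the theorem *)

(** The definition yields some norm limit; interleaving [u] with the constant [l] identifies it as
    [T l]. *)
Lemma completely_continuous_cvg (R : realType) (F G : normedModType R[i])
    (T : {linear F -> G}) (u : nat -> F) (l : F) :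
  completely_continuous T -> weakly_cvg u l -> T \o u @ \oo --> T l.
Proof.
move=> [_ Tcc] ul; pose w n := if odd n then l else u n./2.
have wl : weakly_cvg w l.
  apply: dball_weakly_cvg => g gB; apply/cvgrPdist_lt => e e0.
  have /cvgrPdist_lt/(_ e e0)[N _ NP] := weakly_cvg_dball ul gB.
  exists N.*2 => // n /= Nn; rewrite /w; case: ifPn => [_|nodd].
    by rewrite subrr normr0.
  by apply: NP => /=; rewrite -leq_double even_halfK.
have /cvg_ex[z /cvg_rnormP wz] : cvgn (T \o w) by apply: Tcc; exists l.
have -> : T l = z.
  apply/eqP; rewrite -subr_eq0; apply/eqP/rnorm0_eq0/eqP.
  rewrite eq_le rnorm_ge0 andbT; apply/ler_addgt0Pr => e e0; rewrite add0r.
  have [N _ /(_ N.*2.+1)] := wz e e0.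
  rewrite /= /w /= odd_double /= rnormBC => /(_ _)/ltW; apply.
  by rewrite -addnn -addnS leq_addr.
apply/cvg_rnormP => e e0; have [N _ NP] := wz e e0.
exists N => // n /= Nn; have := NP n.*2; rewrite /= /w odd_double doubleK; apply.
by rewrite -addnn (leq_trans Nn)// leq_addr.
Qed.

Lemma separated_sequence (R : realType) (G : normedModType R[i]) (B : set G) (e : R) :
  (forall l : seq G, exists2 b, B b & forall c, c \in l -> e <= rnorm (b - c)) ->
  exists2 y : nat -> G, (forall n, B (y n)) &
    forall n m, (n < m)%N -> e <= rnorm (y m - y n).
Proof.
move=> far.
have [||f fP] := @dependent_choice_nat (seq G) (fun _ _ => True) (fun _ l l' =>
    exists b, [/\ B b, l' = rcons l b & forall c, c \in l -> e <= rnorm (b - c)]).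
- by exists [::].
- by move=> _ l _; have [b Bb bl] := far l; exists (rcons l b); split => //; exists b.
have fS n : exists b, [/\ B b, f n.+1 = rcons (f n) b &
    forall c, c \in f n -> e <= rnorm (b - c)] by have [] := fP n.
have [y yP] := choice fS.
have yf n m : (n < m)%N -> y n \in f m.
  elim: m => // m IH; have [_ -> _] := yP m.
  rewrite ltnS mem_rcons inE leq_eqVlt => /predU1P[->|/IH ->]; rewrite ?eqxx ?orbT//.
by exists y => [n|n m /yf]; [have [] := yP n|have [_ _] := yP m; exact].
Qed.

(** Without separated sequences [B] has finite nets, so every ultrafilter on its closure is Cauchy
    and converges by completeness. *)
Lemma compact_closure_of_not_separated (R : realType)
    (G : completeNormedModType R[i]) (B : set G) :
  (forall (e : R) (y : nat -> G), 0 < e -> (forall n, B (y n)) ->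
     ~ forall n m, (n < m)%N -> e <= rnorm (y m - y n)) ->
  compact (closure B).
Proof.
move=> nsep; rewrite compact_ultra => W WU WB.
have net (e : R) : 0 < e ->
    exists l : seq G, forall b, B b -> exists2 c, c \in l & rnorm (b - c) < e.
  move=> e0; apply: contrapT => /forallNP nnet.
  have [|y yB ysep] := @separated_sequence _ _ B e; last exact: nsep yB ysep.
  move=> l; have /existsNP[b /not_implyP[Bb bl]] := nnet l; exists b => // c cl.
  by rewrite leNgt; apply/negP => bc; apply: bl; exists c.
have Wc : cauchy W.
  apply/cauchy_exP => e /gt0_complexE[-> e0].
  (* The net has radius [e / 2] because points of the closure must first be approximated within
     [B]. *)
  have e2 : 0 < complex.Re e / 2 by rewrite divr_gt0.
  have [l lB] := net _ e2; apply: contrapT => /forallNP nW.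
  have Wn c : W (~` ball c (complex.Re e)%:C).
    by have [/nW|] := in_ultra_setVsetC (ball c (complex.Re e)%:C) WU.
  have Wl : W [set z | forall c, c \in l -> ~ ball c (complex.Re e)%:C z].
    elim: l {lB} => [|c l IH]; first by apply: filterS filterT.
    apply: filterS2 (Wn c) IH => z zc zl d; rewrite inE => /predU1P[->//|].
    exact: zl.
  have [z [zl zB]] := filter_ex (filterI Wl WB).
  have zV : nbhs z [set b | rnorm (z - b) < complex.Re e / 2].
    have /cvg_rnormP/(_ _ e2) : (fun b : G => b) @ z --> z by exact: cvg_id.
    exact.
  have [b [Bb zb]] := zB _ zV; have [c cl bc] := lB b Bb.
  apply: (zl c cl); rewrite -ball_normE /= norm_rnormE ltcR rnormBC.
  rewrite -(subrKA b) (le_lt_trans (rnormD _ _))//.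
  by rewrite [ltRHS]splitr ltrD.
have [p Wp] : exists p : G, W --> p by apply/cvg_ex; exact: cauchy_cvg.
exists p; split => //; apply: closed_closure => V /Wp WV.
exact: filter_ex (filterI WB WV).
Qed.

(** Consecutive differences of a weakly Cauchy subsequence are weakly null, so their images tend to
    0 and cannot stay separated. *)
Lemma rosenthal_completely_continuous_image (R : realType) (F : normedModType R[i])
    (G : completeNormedModType R[i]) (T : {linear F -> G}) (A : set F) :
  rosenthal A -> completely_continuous T -> compact (closure (T @` A)).
Proof.
move=> Aros Tcc; apply: compact_closure_of_not_separated => e y e0 yA ysep.
have /choice[u uP] : forall n, exists x, A x /\ T x = y n.
  by move=> n; have [x Ax Tx] := yA n; exists x.
have [s sI us] := Aros u (fun n => (uP n).1).
pose d n := u (s n.+1) - u (s n).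
have d0 : weakly_cvg d 0.
  apply: dball_weakly_cvg => g gB.
  have /cvg_ex[z zP] := weakly_cauchy_dball us gB.
  have g0 : g 0 = 0 by rewrite -(subrr (0 : F)) dballB// subrr.
  rewrite g0 (_ : g \o d = fun n => g (u (s n.+1)) - g (u (s n))); last first.
    by apply/funext => n /=; rewrite dballB.
  rewrite -(subrr z); apply: cvgB => //.
  by rewrite (cvg_shiftS (fun n => g (u (s n)))).
have /cvg_rnormP/(_ e e0)[N _ /(_ N (leqnn N))] := completely_continuous_cvg Tcc d0.
rewrite /= linear0 sub0r rnormN linearB !(uP _).2.
by rewrite ltNge ysep// sI.
Qed.

(** * Weighted norms and composition with operators *)

Section Weighted.
Context {R : realType} {E : normedModType R[i]} (U : set E) (v : E -> R).

Lemma wnorm_leP (F : normedModType R[i]) (f : E -> F) (K : R) : 0 <= K ->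
  (wnorm U v f <= K%:E)%E <-> forall x, U x -> v x * rnorm (f x) <= K.
Proof.
move=> K0; rewrite /wnorm ge_max lee_fin K0 /=; split => [/ereal_supP H x Ux|H].
  by rewrite -lee_fin; apply: H; exists x.
by apply: ge_ereal_sup => _ [x Ux <-]; rewrite lee_fin H.
Qed.

Lemma wnorm_ge (F : normedModType R[i]) (f : E -> F) x :
  U x -> ((v x * rnorm (f x))%:E <= wnorm U v f)%E.
Proof. by move=> Ux; rewrite /wnorm le_max ereal_sup_ubound ?orbT//; exists x. Qed.

Lemma wnorm_ltyP (F : normedModType R[i]) (f : E -> F) :
  (wnorm U v f < +oo)%E <->
  exists2 K, 0 <= K & forall x, U x -> v x * rnorm (f x) <= K.
Proof.
split=> [fy|[K K0 fK]]; last by rewrite (@le_lt_trans _ _ K%:E) ?ltry//; apply/wnorm_leP.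
have f0 : (0 <= wnorm U v f)%E by rewrite /wnorm le_max lexx.
have ff : wnorm U v f \is a fin_num by rewrite ge0_fin_numE.
have K0 : 0 <= fine (wnorm U v f) by rewrite fine_ge0.
by exists (fine (wnorm U v f)) => //; apply/(wnorm_leP _ K0); rewrite fineK.
Qed.

Lemma wimage_comp (F G : normedModType R[i]) (T : {linear F -> G}) (f : E -> F) :
  wimage U v (T \o f) = T @` wimage U v f.
Proof.
rewrite /wimage image_comp; apply: eq_imagel => x _.
by rewrite /= linearZ.
Qed.

Lemma Hv_comp (F G : normedModType R[i]) (T : {linear F -> G}) (f : E -> F) :
  (forall x, U x -> 0 < v x) -> continuous T -> Hv U v F f -> Hv U v G (T \o f).
Proof.
move=> v0 cT [fh /wnorm_ltyP[K K0 fK]]; split.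
  move=> x Ux; apply: differentiable_comp; first exact: fh.
  exact: linear_differentiable.
have [M M0 TM] := continuous_rnorm_bounded cT.
apply/wnorm_ltyP; exists (M * K); first by rewrite mulr_ge0// ltW.
move=> x Ux; apply: (@le_trans _ _ (M * (v x * rnorm (f x)))).
  by rewrite mulrCA ler_wpM2l ?TM// ltW// v0.
by rewrite ler_wpM2l ?fK// ltW.
Qed.

End Weighted.

Lemma opnorm_le1 (R : realType) (F G : normedModType R[i]) (T : {linear F -> G}) :
  (opnorm T <= 1)%E <-> forall x, rnorm (T x) <= rnorm x.
Proof.
split=> [/ereal_supP T1 x|T1]; last first.
  apply: ge_ereal_sup => _ [x /= x1 <-]; rewrite lee_fin.
  exact: le_trans (T1 x) x1.
have := rnorm_ge0 x; rewrite le0r => /orP[/eqP x0|x0].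
  by rewrite x0 (rnorm0_eq0 x0) linear0 rnorm0.
have : rnorm (T ((rnorm x)^-1%:C *: x)) <= 1.
  rewrite -lee_fin; apply: T1; exists ((rnorm x)^-1%:C *: x) => //=.
  by rewrite rnormZr gtr0_norm ?invr_gt0// mulVf ?gt_eqF.
by rewrite linearZ rnormZr gtr0_norm ?invr_gt0// mulrC ler_pdivrMr// mul1r.
Qed.

(** * Rank one operators of norm at most 1 *)

Section RankOne.
Variables (R : realType) (F : normedModType R[i]).
Variables (g : F -> R) (gB : dball g) (e : F) (e1 : rnorm e <= 1).

(** Multiplying [x] by a unimodular [c] makes the value real and nonnegative, where the bound on [g]
    applies. *)
Lemma rnorm_cplx x : rnorm (cplx gB x) <= rnorm x.
Proof.
set z := cplx gB x; pose c := z^*%C / `|z|.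
have [z0|z0] := eqVneq z 0; first by rewrite z0 rnorm0 rnorm_ge0.
have nz : `|z| != 0 by rewrite normr_eq0.
have cz : c * z = `|z| by rewrite mulrAC [_ * z]mulrC -sqr_normc expr2 mulfK.
have c1 : `|c| = 1 by rewrite normrM normfV normr_id normcJ divff.
have : g (c *: x) <= rnorm (c *: x) by have [_ _] := gB; exact.
rewrite rnormZ c1 mul1r; apply: le_trans.
rewrite -[g _]/(complex.Re (cplx gB (c *: x))).
by rewrite (_ : cplx gB (c *: x) = `|z|)// linearZ.
Qed.

Definition rank_one (x : F) : F := cplx gB x *: e.

Lemma rank_one_linear : linear rank_one.
Proof. by move=> a x y; rewrite /rank_one linearP scalerDl -scalerA. Qed.

HB.instance Definition _ := GRing.isLinear.Build R[i] F F _ rank_one rank_one_linear.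

Lemma rnorm_rank_one x : rnorm (rank_one x) <= rnorm (cplx gB x).
Proof. by rewrite rnormZ ler_piMr//; exact: (rnorm_ge0 (cplx gB x)). Qed.

Lemma rank_one_le x : rnorm (rank_one x) <= rnorm x.
Proof. exact: le_trans (rnorm_rank_one x) (rnorm_cplx x). Qed.

Lemma rank_one_completely_continuous : completely_continuous rank_one.
Proof.
split.
  by apply: (@bounded_rnorm_continuous _ _ _ rank_one 1) => x; rewrite mul1r rank_one_le.
move=> u [l /(_ (cplx gB) (@cplx_continuous _ _ g gB))/cvg_rnormP ul].
apply/cvg_ex; exists (rank_one l); apply/cvg_rnormP => d /ul.
apply: filterS => n /=; apply: le_lt_trans.
by rewrite -!linearB rnorm_rank_one.
Qed.

End RankOne.

Theorem theorem3p5 (R : realType) (E F : completeNormedModType R[i])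
    (U : set E) (v : E -> R) (oU : open U) (hv : weight U v) :
  HvR U v F = VquoHvK U v F /\
  (forall f : E -> F, HvR U v F f -> wnorm U v f = VquoHvK_norm U v f).
Proof.
have [v0 _] := hv; split.
  apply/seteqP; split => f [fHv].
    move=> fR; split => // G T Tcc; split; first exact: (Hv_comp v0 Tcc.1 fHv).
    rewrite /relatively_compact wimage_comp.
    exact: rosenthal_completely_continuous_image.
  move=> fV; split => //; have [_ /wnorm_ltyP[K K0 fK]] := fHv.
  apply: (@rosenthal_of_completely_continuous _ _ _ K).
    move=> _ [x Ux <-]; rewrite rnormZr gtr0_norm ?v0//; exact: fK.
  (* The hypothesis is applied with [G := linf R]. *)
  move=> T Tcc; have [_] := fV _ T Tcc.
  by rewrite /relatively_compact wimage_comp.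
move=> f [fHv _]; apply/eqP; rewrite eq_le; apply/andP; split.
  have le_norm (G : completeNormedModType R[i]) (T : {linear F -> G}) :
      completely_continuous T -> (opnorm T <= 1)%E ->
      (wnorm U v (T \o f) <= VquoHvK_norm U v f)%E.
    by move=> ? ?; apply: ereal_sup_ubound; exists G, T.
  rewrite {1}/wnorm ge_max; apply/andP; split.
    (* The zero operator is admissible and accounts for the maximum with 0 in [wnorm], also when [U]
       is empty. *)
    have z0 : dball (fun _ : F => 0 : R).
      by split=> [x y|t x|x]; rewrite ?addr0 ?mulr0 ?rnorm_ge0.
    have z1 : rnorm (0 : F) <= 1 by rewrite rnorm0.
    apply: le_trans (le_norm F (rank_one z0 0) _ _).
    - by rewrite /wnorm le_max lexx.
    - exact: rank_one_completely_continuous.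
    - by apply/opnorm_le1; exact: rank_one_le.
  apply: ge_ereal_sup => _ [x Ux <-].
  have [g gB gf] := hahn_banach_norming (f x).
  (* The normalised value of [f x]. When [f x = 0] the inverse of 0 is 0, so [e = 0] and the norm
     bound still holds. *)
  pose e := (rnorm (f x))^-1%:C *: f x.
  have eE : rnorm e = (rnorm (f x))^-1 * rnorm (f x).
    by rewrite rnormZr ger0_norm// invr_ge0 rnorm_ge0.
  have e1 : rnorm e <= 1.
    by rewrite eE; have [->|?] := eqVneq (rnorm (f x)) 0; rewrite ?mulr0// mulVf.
  apply: le_trans (le_norm F (rank_one gB e) _ _).
  - apply: le_trans (wnorm_ge _ _ Ux); rewrite lee_fin ler_wpM2l ?(ltW (v0 _ Ux))//.
    have [->|fx0] := eqVneq (rnorm (f x)) 0; first exact: rnorm_ge0.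
    rewrite rnormZ eE mulVf// mulr1 -gf; apply: le_trans (rnormC_Re (cplx gB (f x))).
    exact: ler_norm.
  - exact: rank_one_completely_continuous.
  - by apply/opnorm_le1; exact: rank_one_le.
apply: ge_ereal_sup => _ [G [T [_ /opnorm_le1 T1 ->]]].
rewrite {1}/wnorm ge_max; apply/andP; split; first by rewrite /wnorm le_max lexx.
apply: ge_ereal_sup => _ [x Ux <-]; apply: le_trans (wnorm_ge _ _ Ux).
by rewrite lee_fin ler_wpM2l ?T1// ltW// v0.
Qed.
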